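(* Let $1\le k<n$ be integers, let $\xi_1,\ldots,\xi_n$ be independent standard normal random variables with order statistics $\xi_{(1)}\le\ldots\le\xi_{(n)}$, and for $\varepsilon>0$ let $A_{n,k}(\varepsilon)=\{\xi_{(n)}-\xi_{(n-k+1)}\le\varepsilon\}$. Let $S^{n-1}=\mathrm{conv}[e_1,\ldots,e_n]$, where $e_1,\ldots,e_n$ is the standard orthonormal basis of $\mathbb R^n$. Then the $k$-th intrinsic volume of $S^{n-1}$ satisfies $$V_k(S^{n-1})=\frac{(2\pi)^{k/2}}{k!}\cdot\lim_{\varepsilon\downarrow0}\varepsilon^{1-k}\,\mathbb E\big[\max\{\xi_1,\ldots,\xi_n\}\,\mathbf 1_{A_{n,k}(\varepsilon)}\big].$$
   Context: $\mathrm{conv}$ denotes the convex hull and $\mathbf 1_A$ the indicator of an event $A$. For a compact convex set $T\subset\mathbb R^n$ the intrinsic volumes $V_0(T),\ldots,V_n(T)$ are defined by the Steiner formula $\mathrm{Vol}_n(T+r\mathbb B_n)=\sum_{k=0}^n\kappa_{n-k}V_k(T)r^{n-k}$ for all $r\ge0$, where $\mathbb B_n$ is the unit ball of $\mathbb R^n$ and $\kappa_k=\pi^{k/2}/\Gamma(\frac k2+1)$. *)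

(* Defs.v *)
From HB Require Import structures.
From mathcomp Require Import all_boot all_order all_algebra.
From mathcomp Require Import all_classical all_reals all_analysis.

Set Implicit Arguments.
Unset Strict Implicit.
Unset Printing Implicit Defensive.

Import Order.TTheory GRing.Theory Num.Theory.
Import numFieldNormedType.Exports.

Local Open Scope classical_set_scope.
Local Open Scope ring_scope.

(* Product Lebesgue measure on R^n, with R^n represented as [n.-tuple R] so as
   to reuse the product sigma-algebra of tuples. *)
Fixpoint lebesgue_tuple (R : realType) (n : nat) :
    set (n.-tuple (measurableTypeR R)) -> \bar R :=
  if n is m.+1 then
    pushforward (@lebesgue_measure R \x @lebesgue_tuple R m)%E
      (fun p => [the m.+1.-tuple _ of p.1 :: p.2])
  else dirac (in_tuple [::]).
Arguments lebesgue_tuple : clear implicits.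

Definition volume (R : realType) (n : nat) (A : set 'rV[R]_n) : \bar R :=
  lebesgue_tuple R n [set t | A (\row_i tnth t i)].

(* The norm carried by ['rV[R]_n] in the library is the sup norm. *)
Definition enorm (R : realType) (n : nat) (x : 'rV[R]_n) : R :=
  Num.sqrt (\sum_(i < n) x 0 i ^+ 2).

Definition unit_ball (R : realType) (n : nat) : set 'rV[R]_n :=
  [set x | enorm x <= 1].
Arguments unit_ball : clear implicits.

Definition convex_hull (R : realType) (n : nat) (A : set 'rV[R]_n) :
  set 'rV[R]_n := smallest (@convex_set R 'rV[R]_n) A.

Definition std_simplex (R : realType) (n : nat) : set 'rV[R]_n :=
  convex_hull (range (fun i : 'I_n => delta_mx 0 i)).
Arguments std_simplex : clear implicits.

Definition Gamma (R : realType) (x : R) : R :=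
  (\int[@lebesgue_measure R]_(t in `]0%R, +oo[) (t `^ (x - 1) * expR (- t)))%R.

Definition kappa (R : realType) (k : nat) : R :=
  pi `^ (k%:R / 2) / Gamma (k%:R / 2 + 1).

Definition steiner_formula (R : realType) (n : nat) (T : set 'rV[R]_n)
    (V : nat -> R) : Prop :=
  forall r : R, 0 <= r ->
    volume [set x + r *: b | x in T & b in unit_ball R n] =
    (\sum_(k < n.+1) kappa R (n - k) * V k * r ^+ (n - k))%:E.

(* For [k <= n] the value is determined by the Steiner formula, when [T]
   satisfies one (as compact convex sets do); for [k > n] it is arbitrary. *)
Definition intrinsic_volume (R : realType) (n : nat) (T : set 'rV[R]_n)
    (k : nat) : R :=
  xget (fun=> 0) [set V : nat -> R | steiner_formula T V] k.

(* The equality of laws is only required on Borel sets: the values of a measure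
   on non-measurable sets carry no meaning. *)
Definition standard_normal (R : realType) (d : measure_display)
    (Omega : measurableType d) (P : probability Omega R) (X : {RV P >-> R}) :
  Prop :=
  forall B : set R, measurable B -> distribution P X B = normal_prob 0 1 B.

Definition mutually_independent (R : realType) (d : measure_display)
    (Omega : measurableType d) (P : probability Omega R) (I : finType)
    (X : I -> {RV P >-> R}) : Prop :=
  forall (J : {set I}) (B : I -> set R),
    (forall i, i \in J -> measurable (B i)) ->
    P (\bigcap_(i in [set` J]) X i @^-1` B i) =
    (\prod_(i in J) P (X i @^-1` B i))%E.

(* [order_stat x j] is the j-th smallest coordinate, for [1 <= j <= n]. *)
Definition order_stat (R : realType) (n : nat) (x : 'I_n -> R) (j : nat) : R :=
  nth 0 (sort <=%R (codom x)) j.-1.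

(* The iterated maximum starts from a coordinate of [x], not from 0, which
   would be wrong when all the coordinates are negative. *)
Definition max_coord (R : realType) (n : nat) (x : 'I_n -> R) : R :=
  \big[Num.max/head 0 (codom x)]_(i < n) x i.

Definition top_gap_event (R : realType) (d : measure_display)
    (Omega : measurableType d) (P : probability Omega R) (n : nat)
    (xi : 'I_n -> {RV P >-> R}) (k : nat) (eps : R) : set Omega :=
  [set w | order_stat (fun i => xi i w) n -
           order_stat (fun i => xi i w) (n - k + 1) <= eps].

(* Main.v *)
(* The metric projection of x onto the simplex is (x - l)_+, where l is such that
   these coordinates sum to 1.  Splitting R^n according to the set I of coordinates
   with x_i > l, and writing x_I = y + l with y in an open simplex, the volume of
   the r-neighbourhood becomes a sum over j = |I| of
     C(n, j) * j / (j - 1)! * |{(l, z) : z <= l, j l^2 + |z|^2 <= r^2}|,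
   and these cone sections are homogeneous of degree n - j + 1 in r: this is the
   Steiner formula with k = j - 1.  Integrating exp(- (j l^2 + |z|^2) / 2) over the
   cone in two ways gives the cone volume as kappa_(n-k) (2 pi)^(k/2) times the
   integral of phi^(k+1) Phi^(n-k-1), phi and Phi being the normal density and
   distribution function.
   On the probability side, conditioning on the almost surely unique index of the
   maximum y, the expectation is n times the integral of y phi(y) P(at least k - 1
   of n - 1 normal variables lie in [y - eps, y], the others below).  Divided by
   eps^(k-1) this converges by dominated convergence to
   n C(n-1, k-1) * int y phi^k Phi^(n-k), and integration by parts turns it into
   the same integral of phi^(k+1) Phi^(n-k-1). *)
Require Import Defs.
From HB Require Import structures.
From mathcomp Require Import all_boot all_order all_algebra.
From mathcomp Require Import all_classical all_reals all_analysis.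
From mathcomp Require Import measurable_realfun real_interval.
From mathcomp Require Import ring lra zify.

Set Implicit Arguments.
Unset Strict Implicit.
Unset Printing Implicit Defensive.

Import Order.TTheory GRing.Theory Num.Theory.
Import numFieldNormedType.Exports.

Local Open Scope classical_set_scope.
Local Open Scope ring_scope.

(** * Powers of a measure and masks *)

(** Three decompositions occur: by the coordinates above the projection threshold, by the coordinate
    realising the maximum, and by the coordinates close to it. Each is a sum over all index sets [A]
    of a function of the two subtuples cut out by [A], in which at most one [A] contributes (outside
    ties, for the maximum). [integral_sum_mask] turns every such sum into binomial coefficients
    times double integrals. Tuples are integrated one coordinate at a time, so changes of variables
    reduce to affine ones on the line. In particular, with j - 1 of the j large coordinates fixed,
    the remaining one is affine in the threshold with slope j, and those j - 1 coordinates then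
    range over a simplex of volume 1/(j - 1)!: this is the factor j / (j - 1)!. [intrinsic_volume]
    picks an arbitrary solution of the Steiner formula, so exhibiting one is not enough: the k-th
    coefficient must be shown unique. This needs kappa_(n-k) to be nonzero, hence the Gamma integral
    at half-integers to be finite and positive. The coefficient of index n is 0, since the simplex
    lies in a hyperplane. *)

Section tuple_power.
Context {d} {T : measurableType d} {R : realType}.
Variable mu : {sigma_finite_measure set T -> \bar R}.
Local Open Scope ereal_scope.

Definition tcons n (p : T * n.-tuple T) : n.+1.-tuple T :=
  [the n.+1.-tuple _ of p.1 :: p.2].

Lemma measurable_tcons n : measurable_fun [set: T * n.-tuple T] (@tcons n).
Proof. exact: measurable_cons. Qed.

Section step.
Variables (n : nat) (m : {sigma_finite_measure set (n.-tuple T) -> \bar R}).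

Definition tuple_step : set (n.+1.-tuple T) -> \bar R :=
  pushforward (mu \x m) (@tcons n).

Let step0 : tuple_step set0 = 0.
Proof. by rewrite /tuple_step /pushforward preimage_set0 measure0. Qed.

Let step_ge0 A : 0 <= tuple_step A.
Proof. exact: (measure_ge0 (mu \x m)). Qed.

Let step_additive : semi_sigma_additive tuple_step.
Proof.
exact: (@measure_semi_sigma_additive _ _ _
  (measure_function_pushforward__canonical__measure_function_Measure
     (mu \x m) (@measurable_tcons n))).
Qed.

HB.instance Definition _ := isMeasure.Build _ _ _
  tuple_step step0 step_ge0 step_additive.

Let step_sigma_finite : sigma_finite setT tuple_step.
Proof.
have /sigma_finiteP[F [TF ndF Foo]] := sigma_finiteT mu.
have /sigma_finiteP[G [TG ndG Goo]] := sigma_finiteT m.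
(* [g] inverts [tcons]: pulling back products of the two exhausting sequences gives sets whose
   measure is a product of two finite values. *)
pose g (t : n.+1.-tuple T) := (thead t, [tuple of behead t]) : T * n.-tuple T.
have mg : measurable_fun setT g.
  by apply/measurable_fun_pair; [exact: measurable_tnth|exact: measurable_behead].
exists (fun k => g @^-1` (F k `*` G k)).
  rewrite -preimage_bigcup; apply/esym/seteqP; split => // t _.
  have [i _ Fi] : (\bigcup_k F k) (g t).1 by rewrite -TF.
  have [j _ Gj] : (\bigcup_k G k) (g t).2 by rewrite -TG.
  exists (maxn i j) => //; split.
    by move: Fi; exact/subsetPset/ndF/leq_maxl.
  by move: Gj; exact/subsetPset/ndG/leq_maxr.
move=> k; have [mF Fk] := Foo k; have [mG Gk] := Goo k; split.
  by rewrite -[_ @^-1` _]setTI; apply: mg => //; exact: measurableX.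
rewrite /tuple_step /pushforward -comp_preimage.
rewrite (_ : g \o _ = id) ?preimage_id; last first.
  apply/funext => -[x t]; rewrite /g/=; congr pair.
  exact/val_inj.
by rewrite product_measure1E// lte_mul_pinfty// ge0_fin_numE.
Qed.

HB.instance Definition _ := Measure_isSigmaFinite.Build _ _ _
  tuple_step step_sigma_finite.

End step.

(** The recursion is that of [lebesgue_tuple], for a general [mu] so that it also yields the law of
    independent normal variables. Each stage is bundled as sigma-finite because Fubini at the next
    stage asks for it. *)
Fixpoint tuple_power n : {sigma_finite_measure set (n.-tuple T) -> \bar R} :=
  if n is m.+1 then tuple_step (tuple_power m) else dirac (in_tuple [::]).

Lemma integral_tuple_power0 (f : 0.-tuple T -> \bar R) :
  (forall t, 0 <= f t) -> \int[tuple_power 0]_t f t = f [tuple].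
Proof.
move=> f0; rewrite /= integral_dirac//.
  by rewrite diracT mul1e; congr f; exact/val_inj.
move=> _ Y mY; rewrite setTI.
have [|] := pselect (Y (f [tuple])) => h.
  rewrite (_ : _ @^-1` _ = setT); first exact: measurableT.
  by apply/seteqP; split => // t _ /=; rewrite (tuple0 t).
rewrite (_ : _ @^-1` _ = set0); first exact: measurable0.
by apply/seteqP; split => // t /=; rewrite (tuple0 t).
Qed.

Lemma integral_tuple_powerS n (f : n.+1.-tuple T -> \bar R) :
  measurable_fun [set: n.+1.-tuple T] f -> (forall t, 0 <= f t) ->
  \int[tuple_power n.+1]_t f t =
  \int[mu]_x \int[tuple_power n]_t f (tcons (x, t)).
Proof.
move=> mf f0; rewrite /= /tuple_step.
rewrite (ge0_integral_pushforward (@measurable_tcons n))//.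
rewrite preimage_setT fubini_tonelli1//.
  by apply: measurableT_comp => //; exact: measurable_tcons.
by move=> x; exact: f0.
Qed.


Lemma tmask_subproof (U : Type) n (b : n.-tuple bool) (x : n.-tuple U) :
  size (mask b x) == count id b.
Proof. by rewrite size_mask// !size_tuple. Qed.

Definition tmask (U : Type) n (b : n.-tuple bool) (x : n.-tuple U) :=
  Tuple (tmask_subproof b x).

(** Each entry of the masked tuple is a coordinate of [x], whose index is found by masking the tuple
    of all indices. *)
Lemma measurable_tmask n (b : n.-tuple bool) :
  measurable_fun [set: n.-tuple T] (@tmask T n b).
Proof.
apply/measurable_fun_tnthP => i.
rewrite (_ : _ \o _ = fun x => tnth x (tnth (tmask b (ord_tuple n)) i)).
  exact: measurable_tnth.
apply/funext => x /=; rewrite -[RHS](tnth_map (tnth x)).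
congr (tnth _ i); apply/val_inj => /=.
by rewrite map_mask/= map_tnth_enum.
Qed.

Definition double_integral (G : seq T -> seq T -> \bar R) i m :=
  \int[tuple_power i]_u \int[tuple_power m]_v G u v.

(** The integrands act on sequences, so that one [G] serves for all ways of splitting a tuple;
    measurability is then asked for each pair of lengths. *)
Definition seq_measurable (G : seq T -> seq T -> \bar R) := forall i m,
  measurable_fun [set: i.-tuple T * m.-tuple T] (fun p => G p.1 p.2).

Lemma seq_measurable_comp d' (Z : measurableType d') G i m
    (f : Z -> i.-tuple T) (g : Z -> m.-tuple T) :
  seq_measurable G -> measurable_fun setT f -> measurable_fun setT g ->
  measurable_fun setT (fun z => G (f z) (g z)).
Proof.
move=> mG mf mg.
exact: (measurableT_comp (mG i m) (measurable_fun_pair mf mg)).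
Qed.

Lemma seq_measurable_mask G n (b : n.-tuple bool) : seq_measurable G ->
  measurable_fun [set: n.-tuple T] (fun x => G (mask b x) (mask (map negb b) x)).
Proof.
move=> mG; apply: (seq_measurable_comp (f := @tmask T n b)
  (g := @tmask T n [tuple of map negb b]) mG); exact: measurable_tmask.
Qed.

(** Induction on the tuple: the first bit of [b] decides which argument of [G] receives the first
    coordinate, and the induction hypothesis is applied to [G] with that coordinate consed on. *)
Lemma integral_mask G n (b : n.-tuple bool) :
  seq_measurable G -> (forall u v, 0 <= G u v) ->
  \int[tuple_power n]_x G (mask b x) (mask (map negb b) x) =
  double_integral G (count id b) (count negb b).
Proof.
elim: n b G => [|n IH] b G mG G0.
  rewrite (tuple0 b) /double_integral !integral_tuple_power0//.
  by move=> t; exact: integral_ge0.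
have mF i m : measurable_fun [set: i.-tuple T]
    (fun u => \int[tuple_power m]_v G u v).
  have := mG i m.
  move/(measurable_fun_fubini_tonelli_F (m2 := tuple_power m)
    (fun p : i.-tuple T * m.-tuple T => G p.1 p.2)); exact.
rewrite integral_tuple_powerS//; last exact: seq_measurable_mask.
case/tupleP: b => -[] b /=.
- transitivity (\int[mu]_x double_integral (fun u => G (x :: u))
    (count id b) (count negb b)).
    apply: eq_integral => x _; rewrite -IH//.
    move=> i m; apply: (seq_measurable_comp (f := fun p => tcons (x, p.1))
      (g := snd) mG) => //.
    exact: (measurable_cons (measurable_cst x) measurable_fst).
  rewrite add1n add0n /double_integral integral_tuple_powerS//.
  by move=> t; exact: integral_ge0.
- transitivity (\int[mu]_x double_integral (fun u v => G u (x :: v))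
    (count id b) (count negb b)).
    apply: eq_integral => x _; rewrite -IH//.
    move=> i m; apply: (seq_measurable_comp (f := fst)
      (g := fun p => tcons (x, p.2)) mG) => //.
    exact: (measurable_cons (measurable_cst x) measurable_snd).
  rewrite add1n add0n /double_integral.
  set i := count id b; set m := count negb b.
  (* The peeled coordinate belongs to the second block, so its integral has to pass inside the one
     over [u], by Tonelli. *)
  transitivity (\int[mu]_x \int[tuple_power i]_u
      (fubini_F (tuple_power m) (fun p : (T * i.-tuple T) * m.-tuple T =>
         G p.1.2 (p.1.1 :: p.2)) (x, u))); first by [].
  rewrite fubini_tonelli//; last first.
  - by move=> p; exact: integral_ge0.
  - apply: measurable_fun_fubini_tonelli_F => //.
    apply: (seq_measurable_comp (f := fun p => p.1.2)
      (g := fun p => tcons (p.1.1, p.2)) mG).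
      exact: (measurableT_comp measurable_snd measurable_fst).
    apply: measurable_cons measurable_snd.
    exact: (measurableT_comp measurable_fst measurable_fst).
  apply: eq_integral => u _; rewrite integral_tuple_powerS//.
  by apply: (seq_measurable_comp (f := cst u) (g := id) mG).
Qed.

Definition mask_of n (A : {set 'I_n}) : n.-tuple bool := [tuple i \in A | i < n].

Lemma count_mask_of n (A : {set 'I_n}) : count id (mask_of A) = #|A|.
Proof.
rewrite /= count_map cardE /enum_mem size_filter filter_predT.
exact: eq_count.
Qed.

(** Each integral depends on [A] only through its cardinality, and 'C(n, j) sets have cardinality
    j. *)
Lemma integral_sum_mask G n :
  seq_measurable G -> (forall u v, 0 <= G u v) ->
  \int[tuple_power n]_x (\sum_(A : {set 'I_n})
      G (mask (mask_of A) x) (mask (map negb (mask_of A)) x)) =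
  \sum_(j < n.+1) ('C(n, j)%:R)%:E * double_integral G j (n - j).
Proof.
move=> mG G0; rewrite ge0_integral_sum//; last first.
  by move=> A; exact: seq_measurable_mask.
under eq_bigr => A _.
  rewrite integral_mask// count_mask_of.
  rewrite (_ : count negb _ = (n - #|A|)%N); last first.
    by rewrite -count_mask_of -[X in (X - _)%N](size_tuple (mask_of A))
      -(count_predC id) addKn.
  over.
rewrite (partition_big (fun A : {set 'I_n} => inord #|A| : 'I_n.+1) predT)//=.
apply: eq_bigr => j _.
have cA (A : {set 'I_n}) : (inord #|A| == j) = (#|A| == j).
  rewrite -val_eqE/= inordK// ltnS -[X in (_ <= X)%N]card_ord.
  exact: max_card.
rewrite (eq_bigl (fun A : {set 'I_n} => #|A| == j)) => [|A]; last exact: cA.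
rewrite (eq_bigr (fun=> double_integral G j (n - j))); last first.
  by move=> A /eqP ->.
rewrite sumr_const mule_natl; congr (_ *+ _).
have -> : 'C(n, j) = #|[set A : {set 'I_n} | #|A| == j]%SET|.
  by rewrite card_draws card_ord.
by rewrite cardsE.
Qed.

End tuple_power.

Lemma lebesgue_tupleE (R : realType) n :
  lebesgue_tuple R n = tuple_power (@lebesgue_measure R) n.
Proof. by elim: n => [//|n IH] /=; rewrite IH. Qed.

(** * Iverson brackets and affine substitution *)

Definition iverson (R : realType) (b : bool) : \bar R := (b%:R)%:E.
Arguments iverson {R} b.

Section iverson.
Context {R : realType}.
Local Open Scope ereal_scope.

Lemma iverson_ge0 b : 0 <= iverson b :> \bar R.
Proof. by case: b; rewrite lee_fin. Qed.

Lemma iverson_and a b : iverson (a && b) = iverson a * iverson b :> \bar R.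
Proof. by case: a; rewrite /iverson/= ?mul1e ?mul0e. Qed.

Lemma measurable_iverson d (Z : measurableType d) (b : Z -> bool) :
  measurable_fun setT b -> measurable_fun setT (fun z => iverson (b z) : \bar R).
Proof.
move=> mb; rewrite (_ : (fun _ => _) = fun z => if b z then 1 else 0).
  exact: measurable_fun_ifT.
by apply/funext => z; case: (b z).
Qed.

Lemma measurable_set_of_bool d (Z : measurableType d) (b : Z -> bool) :
  measurable_fun setT b -> measurable [set z | b z].
Proof. by move=> mb; rewrite -[X in measurable X]setTI; exact: mb. Qed.

Lemma integral_iverson d (Z : measurableType d)
    (m : {measure set Z -> \bar R}) (b : Z -> bool) :
  measurable_fun setT b -> \int[m]_z iverson (b z) = m [set z | b z].
Proof.
move=> mb; transitivity (m ([set z | b z] `&` setT)); last by rewrite setIT.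
rewrite -integral_indic//; last exact: measurable_set_of_bool.
by apply: eq_integral => z _; rewrite indicE mem_setE.
Qed.

End iverson.
#[global] Hint Resolve iverson_ge0 : core.

Section tuple_measurability.
Context {R : realType} d (Z : measurableType d).
Local Notation T := (measurableTypeR R).

Lemma measurable_sum_tuple n (h : Z -> T -> R) (g : Z -> n.-tuple T) :
  measurable_fun setT (fun p => h p.1 p.2) -> measurable_fun setT g ->
  measurable_fun setT (fun z => \sum_(y <- g z) h z y).
Proof.
move=> mh mg.
rewrite (_ : (fun _ => _) = fun z => \sum_(i < n) h z (tnth (g z) i)).
  apply: measurable_sum => i.
  apply: (measurableT_comp (f := fun p => h p.1 p.2) (g := fun z => (z, tnth (g z) i)) mh).
  apply: measurable_fun_pair => //.
  exact: (measurableT_comp (measurable_tnth i) mg).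
by apply/funext => z; rewrite big_tuple.
Qed.

Lemma measurable_all_tuple n (h : Z -> T -> bool) (g : Z -> n.-tuple T) :
  measurable_fun setT (fun p => h p.1 p.2) -> measurable_fun setT g ->
  measurable_fun setT (fun z => all (h z) (g z)).
Proof.
move=> mh mg.
rewrite (_ : (fun _ => _) = fun z => \big[andb/true]_(i < n) h z (tnth (g z) i)).
  have mi i : measurable_fun setT (fun z => h z (tnth (g z) i)).
    apply: (measurableT_comp (f := fun p => h p.1 p.2) (g := fun z => (z, tnth (g z) i)) mh).
    apply: measurable_fun_pair => //.
    exact: (measurableT_comp (measurable_tnth i) mg).
  elim: (index_enum _) => [|i s IH].
    by under eq_fun do rewrite big_nil; exact: measurable_cst.
  by under eq_fun do rewrite big_cons; exact: measurable_and.
by apply/funext => z; rewrite -big_all big_tuple.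
Qed.

End tuple_measurability.

Section lebesgue_affine.
Context {R : realType}.
Local Notation mu := (@lebesgue_measure R).

(** The image of Lebesgue measure under the affine map, multiplied by [a], agrees with Lebesgue
    measure on half-open intervals, hence everywhere. *)
Lemma lebesgue_integral_affine (a b : R) (f : R -> \bar R) : 0 < a ->
  measurable_fun setT f -> (forall x, 0 <= f x)%E ->
  (\int[mu]_x f x = a%:E * \int[mu]_x f (a * x + b)%R)%E.
Proof.
move=> a0 mf f0.
have mphi : measurable_fun [set: measurableTypeR R]
    (fun x : measurableTypeR R => (a * x + b)%R : measurableTypeR R).
  by apply: measurable_funD => //; exact: measurable_funM.
pose nu := mscale (NngNum (ltW a0))
  (measure_function_pushforward__canonical__measure_function_Measure mu mphi).
have nuE A : measurable A -> mu A = nu A.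
  apply: lebesgue_measure_unique => X [[c e] /= _ <-].
  rewrite /nu /mscale/= /pushforward.
  rewrite (_ : _ @^-1` _ = `](c - b) / a, (e - b) / a]%classic); last first.
    apply/seteqP; split => x /=; rewrite !in_itv/= ltr_pdivrMr// ler_pdivlMr// ltrBlDr lerBrDr mulrC; exact.
  rewrite !lebesgue_measure_itv/= !lte_fin ltr_pM2r ?invr_gt0// ltrD2r.
  case: ifPn => _; last by rewrite mule0.
  rewrite -!EFinD -EFinM; congr EFin; field.
  by rewrite gt_eqF.
rewrite (@eq_measure_integral _ _ _ _ nu); last by move=> A mA _; exact: nuE.
rewrite /nu ge0_integral_mscale//=.
by rewrite (ge0_integral_pushforward mphi)//= preimage_setT.
Qed.

End lebesgue_affine.

(** * The simplex *)

Section product_integrals.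
Context d (T : measurableType d) {R : realType}.
Variable mu : {sigma_finite_measure set T -> \bar R}.

Lemma measurable_prod_tuple n (f : T -> R) :
  measurable_fun setT f ->
  measurable_fun [set: n.-tuple T] (fun t => \prod_(y <- t) f y).
Proof.
move=> mf.
rewrite (_ : (fun _ => _) = fun t : n.-tuple T => \prod_(i < n) f (tnth t i)).
  apply: measurable_prod => i _; apply: measurableT_comp => //.
  exact: measurable_tnth.
by apply/funext => z; rewrite big_tuple.
Qed.

Lemma integral_prod_tuple n (f : T -> R) c :
  measurable_fun setT f -> (forall x, 0 <= f x) ->
  (\int[mu]_x (f x)%:E = c%:E)%E ->
  (\int[tuple_power mu n]_t (\prod_(y <- t) f y)%:E = (c ^+ n)%:E)%E.
Proof.
move=> mf f0 fc.
have p0 (s : seq T) : 0 <= \prod_(y <- s) f y by exact: prodr_ge0.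
elim: n => [|n IH].
  rewrite integral_tuple_power0 ?big_nil ?expr0// => t; rewrite lee_fin.
  exact: p0.
rewrite integral_tuple_powerS; [|by apply/measurable_EFinP; exact: measurable_prod_tuple|by move=> t; rewrite lee_fin; exact: p0].
transitivity (\int[mu]_x ((f x)%:E * (c ^+ n)%:E))%E.
  apply: eq_integral => x _; rewrite -IH -ge0_integralZl_EFin//.
  - by apply: eq_integral => t _ /=; rewrite big_cons EFinM.
  - by move=> t _; rewrite lee_fin; exact: p0.
  - by apply/measurable_EFinP; exact: measurable_prod_tuple.
rewrite ge0_integralZr//; last 3 first.
- exact/measurable_EFinP.
- by move=> x _; rewrite lee_fin.
- by rewrite -IH; apply: integral_ge0 => t _; rewrite lee_fin; exact: p0.
by rewrite fc -EFinM exprS.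
Qed.

End product_integrals.

Section simplex.
Context {R : realType}.
Local Notation mu := (@lebesgue_measure R).
Local Notation T := (measurableTypeR R).
Local Notation leb := (tuple_power mu).

Lemma continuous_derive_FTC2 (F f : R -> R) (a b : R) : a < b ->
  (forall x : R, is_derive x (1 : R) F (f x)) -> continuous f ->
  (\int[mu]_(x in `[a, b]) (f x)%:E = (F b)%:E - (F a)%:E)%E.
Proof.
move=> ab dF cf.
have cF x : {for x, continuous F}.
  by apply/differentiable_continuous; apply/derivable1_diffP; have [] := dF x.
apply: continuous_FTC2 => //.
- exact: continuous_subspaceT.
- split=> [x _||]; [by have [] := dF x|..].
    exact/cvg_at_right_filter/cF.
  exact/cvg_at_left_filter/cF.
- by move=> x _; rewrite derive1E; exact: derive_val.
Qed.

(** Inductive step of [simplex_volume]: a first coordinate [x] leaves the amount [lam + s - x] to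
    the sum of the others. [F] below is the explicit primitive. *)
Lemma integral_power_below (lam s : R) i : 0 < s ->
  (\int[mu]_x (((lam < x) && (x < lam + s))%:R *
     ((lam + s - x) ^+ i / i`!%:R))%:E = (s ^+ i.+1 / i.+1`!%:R)%:E)%E.
Proof.
move=> s0.
pose g : R -> R := cst (lam + s) - id.
pose F : R -> R := (- (i.+1`!%:R)^-1) \*: (g ^+ i.+1).
pose f (x : R) : R := (lam + s - x) ^+ i / i`!%:R.
have dF (x : R) : is_derive x (1 : R) F (f x).
  have fi : i`!%:R != 0 :> R by rewrite pnatr_eq0 -lt0n fact_gt0.
  rewrite /F /g; apply: is_derive_eq.
  rewrite /f !fctE /= factS natrM.
  rewrite sub0r scalerN /GRing.scale/=; field.
  by rewrite fi ?natr1 ?nat1r pnatr_eq0.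
have cf : continuous f.
  move=> x; apply: cvgMl.
  apply: (cvg_comp (fun y => lam + s - y) (fun z => z ^+ i)); last first.
    exact: exprn_continuous.
  by apply: cvgB; [exact: cvg_cst|exact: cvg_id].
have lts : lam < lam + s by rewrite ltrDl.
transitivity (\int[mu]_(x in `[lam, (lam + s)%R]) (f x)%:E)%E; last first.
  rewrite (continuous_derive_FTC2 lts dF cf) /F /g !fctE/=.
  rewrite subrr expr0n/= scaler0 -EFinD add0r scaleNr opprK.
  by rewrite addrAC subrr add0r mulrC.
rewrite integral_itv_bndoo; last first.
  by apply/measurable_EFinP/measurable_funTS; exact: continuous_measurable_fun.
rewrite [RHS]integral_mkcond; apply: eq_integral => x _.
by rewrite patchE mem_setE in_itv/=; case: ifP => _; rewrite ?mul1r ?mul0r.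
Qed.

Lemma simplex_volume (lam s : R) i : 0 < s ->
  (\int[leb i]_u iverson (all (fun y => lam < y)%R u &&
     (\sum_(y <- u) (y - lam) < s)%R) = (s ^+ i / i`!%:R)%:E)%E.
Proof.
elim: i s => [|i IH] s s0.
  rewrite integral_tuple_power0//= big_nil s0 /iverson/= expr0 fact0 divr1.
  by [].
have mall n : measurable_fun [set: n.-tuple T] (fun u => all (fun y => lam < y) u).
  apply: (measurable_all_tuple (h := fun _ y => lam < y) (g := id)) => //.
  exact: measurable_fun_ltr.
rewrite integral_tuple_powerS//; last first.
  apply: measurable_iverson; apply: measurable_and; first exact: mall.
  apply: measurable_fun_ltr => //.
  apply: (measurable_sum_tuple (h := fun _ y => y - lam) (g := id)) => //.
  exact: measurable_funB.
rewrite -(integral_power_below lam i s0); apply: eq_integral => x _.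
have [lx|xl] := ltP lam x; last first.
  rewrite mul0r integral0_eq// => t _ /=.
  by rewrite ltNge xl.
(* From [lam + s] on, the first coordinate alone exhausts the sum, the other terms being
   positive. *)
have [xs|sx] := ltP x (lam + s); last first.
  rewrite mul0r integral0_eq// => t _ /=; rewrite lx/= big_cons.
  case: (boolP (all _ _)) => //= /allP lt.
  rewrite ltNge (_ : (s <= _)%R)// -[s]addr0 lerD//; first by rewrite lerBrDl.
  rewrite big_seq sumr_ge0// => y /lt/=; rewrite subr_ge0; exact: ltW.
rewrite mul1r -IH; last by rewrite subr_gt0.
apply: eq_integral => t _ /=; rewrite lx/= big_cons; congr (iverson (_ && _)).
by apply/idP/idP; lra.
Qed.


(** The number l for which the entries of [u], lowered by l, sum to 1. It is only meaningful for
    nonempty [u]. *)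
Definition level (u : seq R) : R := (\sum_(y <- u) y - 1) / (size u)%:R.

(** For a fixed tail the first coordinate is replaced by the level as integration variable, with
    Jacobian i + 1; the tail then runs over a simplex of dimension i and side 1, of volume 1 /
    i!. *)
Lemma integral_level i (h : R -> \bar R) :
  measurable_fun setT h -> (forall x, 0 <= h x)%E ->
  (\int[leb i.+1]_u (iverson (all (fun y => level u < y)%R u) * h (level u)) =
  ((i.+1)%:R / i`!%:R)%:E * \int[mu]_l h l)%E.
Proof.
move=> mh h0.
have mc : measurable_fun [set: i.+1.-tuple T] level.
  rewrite (_ : level = fun u => (\sum_(y <- u) y - 1) / (size u)%:R)//.
  rewrite (_ : (fun _ => _) = fun u : i.+1.-tuple T => (\sum_(y <- u) y - 1) / i.+1%:R).
    apply: measurable_funM => //; apply: measurable_funB => //.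
    by apply: (measurable_sum_tuple (h := fun _ y => y) (g := id)) => //; exact: measurable_snd.
  by apply/funext => u; rewrite size_tuple.
pose F (u : i.+1.-tuple T) : \bar R :=
  (iverson (all (fun y => level u < y)%R u) * h (level u))%E.
have mF : measurable_fun setT F.
  apply: emeasurable_funM; last exact: measurableT_comp.
  apply: measurable_iverson.
  apply: (measurable_all_tuple (h := fun (u : i.+1.-tuple T) y => level u < y) (g := id)) => //.
  by apply: measurable_fun_ltr => //; exact: (measurableT_comp mc).
have F0 u : (0 <= F u)%E by rewrite mule_ge0.
rewrite integral_tuple_powerS//.
rewrite (fubini_tonelli (fun p => F (tcons p)))//; last first.
  by apply: measurableT_comp => //; exact: measurable_tcons.
have i1 : i.+1%:R != 0 :> R by rewrite pnatr_eq0.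
pose K (l : R) (t : i.-tuple T) : \bar R :=
  (iverson (all (fun y => l < y)%R t && (\sum_(y <- t) (y - l) < 1)%R) * h l)%E.
have mK : measurable_fun setT (fun p => K p.1 p.2).
  apply: emeasurable_funM; last exact: measurableT_comp.
  apply: measurable_iverson; apply: measurable_and.
    apply: (measurable_all_tuple (h := fun (u : R * i.-tuple T) y => u.1 < y) (g := snd)) => //.
    apply: measurable_fun_ltr => //.
    exact: (measurableT_comp measurable_fst measurable_fst).
  apply: measurable_fun_ltr => //.
  apply: (measurable_sum_tuple (h := fun (u : R * i.-tuple T) y => y - u.1) (g := snd)) => //.
  apply: measurable_funB => //.
  exact: (measurableT_comp measurable_fst measurable_fst).
have K0 l t : (0 <= K l t)%E by rewrite mule_ge0.
transitivity (\int[leb i]_t (i.+1%:R%:E * \int[mu]_l K l t))%E.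
  apply: eq_integral => t _.
  (* Slope and intercept express the first coordinate through the level [l] when the tail is [t]. *)
  rewrite [LHS](@lebesgue_integral_affine _ i.+1%:R (1 - \sum_(y <- t) y))//; last first.
    apply: (measurableT_comp mF).
    exact: (measurable_cons (f := id) (g := cst t)).
  congr (_ * _)%E; apply: eq_integral => l _.
  rewrite /F /K.
  have -> : level (tcons (i.+1%:R * l + (1 - \sum_(y <- t) y), t)) = l.
    rewrite /level /= big_cons size_tuple.
    by apply: (mulfI i1); rewrite mulrCA divff// mulr1; ring.
  (* In the new variable, requiring the first coordinate to exceed [l] amounts to the sum of the
     [y - l] over the tail being less than 1. *)
  congr (iverson _ * _)%E; rewrite /= andbC; congr andb.
  have -> : \sum_(y <- t) (y - l) = \sum_(y <- t) y - i%:R * l.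
    by rewrite sumrB big_const_seq count_predT iter_addr_0 size_tuple mulr_natl.
  rewrite -natr1.
  by apply/idP/idP; lra.
rewrite ge0_integralZl_EFin//; last 2 first.
- by move=> t _; exact: integral_ge0.
- exact: (measurable_fun_fubini_tonelli_G (m1 := mu) (fun p => K p.1 p.2)).
transitivity (i.+1%:R%:E * \int[mu]_l \int[leb i]_t K l t)%E.
  congr (_ * _)%E.
  exact/esym/(fubini_tonelli (m1 := mu) (m2 := leb i) (fun p => K p.1 p.2)).
rewrite (_ : (i.+1%:R / i`!%:R)%:E = i.+1%:R%:E * (i`!%:R^-1)%:E)%E; last by rewrite EFinM.
rewrite -muleA; congr (_ * _)%E.
rewrite -ge0_integralZl_EFin//; apply: eq_integral => l _.
rewrite /K /= ge0_integralZr//; last first.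
  apply: measurable_iverson; apply: measurable_and.
    by apply: (measurable_all_tuple (h := fun (u : i.-tuple T) y => l < y) (g := id)) => //; exact: measurable_fun_ltr.
  apply: measurable_fun_ltr => //.
  apply: (measurable_sum_tuple (h := fun (u : i.-tuple T) y => y - l) (g := id)) => //.
  exact: measurable_funB.
by rewrite simplex_volume// expr1n div1r.
Qed.

(** As [f] acts on sequences, the induction applies to [f] with the scaled first coordinate consed
    on. *)
Lemma integral_tuple_scale n (c : R) (f : seq R -> \bar R) : 0 < c ->
  (forall m, measurable_fun setT (fun t : m.-tuple T => f t)) -> (forall t, 0 <= f t)%E ->
  (\int[leb n]_t f t = (c ^+ n)%:E * \int[leb n]_t f (map ( *%R c) t))%E.
Proof.
move=> c0; elim: n f => [|n IH] f mf f0.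
  by rewrite !integral_tuple_power0//= expr0 mul1e.
have mmap m : measurable_fun setT (fun t : m.-tuple T => [tuple of map ( *%R c) t] : m.-tuple T).
  apply/measurable_fun_tnthP => j.
  rewrite (_ : _ \o _ = fun t => c * tnth t j).
    by apply: measurable_funM => //; exact: measurable_tnth.
  by apply/funext => t /=; rewrite tnth_map.
have mcf m : measurable_fun setT (fun t : m.-tuple T => f (map ( *%R c) t)).
  exact: (measurableT_comp (mf m) (mmap m)).
have mc x m : measurable_fun setT (fun t : m.-tuple T => f (x :: t)).
  exact: (measurableT_comp (mf m.+1) (measurable_cons (f := cst x) (g := id) (measurable_cst _) (@measurable_id _ _ _))).
have mint m : measurable_fun setT (fun x : T => \int[leb m]_t f (x :: t))%E.
  apply: (measurable_fun_fubini_tonelli_F (m2 := leb m) (fun p : T * m.-tuple T => f (p.1 :: p.2))) => //.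
  exact: (measurableT_comp (mf m.+1) (@measurable_tcons _ _ _)).
rewrite !integral_tuple_powerS//=.
rewrite [LHS](@lebesgue_integral_affine _ c 0)//; last 2 first.
- exact: mint.
- by move=> x; exact: integral_ge0.
rewrite exprS EFinM -muleA; congr (_ * _)%E.
rewrite -ge0_integralZl_EFin//; last 3 first.
- by move=> x _; exact: integral_ge0.
- apply: (measurable_fun_fubini_tonelli_F (m2 := leb n) (fun p : T * n.-tuple T => f (c * p.1 :: map ( *%R c) p.2))) => //.
  exact: (measurableT_comp (mcf n.+1) (@measurable_tcons _ _ _)).
- by rewrite exprn_ge0// ltW.
apply: eq_integral => x _; rewrite addr0.
by rewrite (IH (fun t => f (c * x :: t))).
Qed.

End simplex.

(** * Cone sections and the pieces of the neighbourhood of the simplex *)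

Section steiner_pieces.
Context {R : realType}.
Local Notation mu := (@lebesgue_measure R).
Local Notation T := (measurableTypeR R).
Local Notation leb := (tuple_power mu).

Lemma measurable_level n : measurable_fun [set: n.-tuple T] (@level R).
Proof.
rewrite (_ : @level R = fun u => (\sum_(y <- u) y - 1) / (size u)%:R)//.
rewrite (_ : (fun _ => _) = fun u : n.-tuple T => (\sum_(y <- u) y - 1) / n%:R).
  apply: measurable_funM => //; apply: measurable_funB => //.
  by apply: (measurable_sum_tuple (h := fun _ y => y) (g := id)) => //; exact: measurable_snd.
by apply/funext => u; rewrite size_tuple.
Qed.

(** The head [l] is the threshold and [i.+1] the number of coordinates above it. Each of these lies
    at signed distance [l] from the corresponding coordinate of the projection, whence the weight of
    [l ^+ 2]; [rho] is a squared radius. *)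
Definition in_cone_ball i (rho : R) (t : seq R) : bool :=
  if t is l :: v then
    all (fun y => y <= l) v && (i.+1%:R * l ^+ 2 + \sum_(y <- v) y ^+ 2 <= rho)
  else false.

Lemma measurable_in_cone_ball d (Z : measurableType d) i n
    (f : Z -> R) (g : Z -> n.-tuple T) :
  measurable_fun setT f -> measurable_fun setT g ->
  measurable_fun setT (fun z => in_cone_ball i (f z) (g z)).
Proof.
case: n g => [|n] g mf mg.
  rewrite (_ : (fun _ => _) = cst false); first exact: measurable_cst.
  by apply/funext => z; rewrite (tuple0 (g z)).
have mh : measurable_fun setT (fun z => thead (g z)).
  exact: (measurableT_comp (measurable_tnth ord0) mg).
have mt : measurable_fun setT (fun z => [tuple of behead (g z)]).
  exact: (measurableT_comp (@measurable_behead _ T n) mg).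
rewrite (_ : (fun _ => _) = fun z =>
    all (fun y => y <= thead (g z)) [tuple of behead (g z)] &&
    (i.+1%:R * (thead (g z)) ^+ 2 + \sum_(y <- [tuple of behead (g z)]) y ^+ 2 <= f z)).
  apply: measurable_and.
    apply: (measurable_all_tuple (h := fun z y => y <= thead (g z))) => //.
    apply: measurable_fun_ler => //.
    exact: (measurableT_comp mh measurable_fst).
  apply: measurable_fun_ler => //.
  apply: measurable_funD; last first.
    apply: (measurable_sum_tuple (h := fun _ y => y ^+ 2)) => //.
    exact: measurable_funX.
  by apply: measurable_funM => //; exact: measurable_funX.
by apply/funext => z; rewrite {1}(tuple_eta (g z)).
Qed.

Definition cone_volume i m (rho : R) : \bar R :=
  (\int[leb m.+1]_t iverson (in_cone_ball i rho t))%E.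

Lemma measurable_iverson_cone_ball i rho m :
  measurable_fun setT (fun t : m.-tuple T => iverson (in_cone_ball i rho t) : \bar R).
Proof.
apply: measurable_iverson.
exact: (measurable_in_cone_ball _ (f := cst rho) (g := id)).
Qed.

Lemma cone_volume_scale i m (c : R) : 0 < c ->
  cone_volume i m (c ^+ 2) = ((c ^+ m.+1)%:E * cone_volume i m 1)%E.
Proof.
move=> c0.
rewrite /cone_volume (integral_tuple_scale _ (f := fun t => iverson (in_cone_ball i (c ^+ 2) t)) c0)//; last first.
  by move=> n; exact: measurable_iverson_cone_ball.
congr (_ * _)%E; apply: eq_integral => t _; congr iverson.
rewrite (tuple_eta t) /= big_map all_map; congr andb.
  by apply: eq_all => y /=; rewrite ler_pM2l.
under eq_bigr do rewrite exprMn.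
rewrite -mulr_sumr exprMn mulrCA -mulrDr.
by rewrite -[X in (_ <= X) = _]mulr1 ler_pM2l// exprn_gt0.
Qed.

(** The quadratic form forces [l = 0], a null set. This is the radius 0 of the Steiner formula, out
    of reach of scaling by a positive factor. *)
Lemma cone_volume0 i m : cone_volume i m 0 = 0%E.
Proof.
rewrite /cone_volume integral_tuple_powerS//; last exact: measurable_iverson_cone_ball.
transitivity (\int[mu]_(x in [set 0%R]) \int[leb m]_t iverson (in_cone_ball i 0 (tcons (x, t))))%E.
  rewrite [RHS]integral_mkcond; apply: eq_integral => x _.
  rewrite patchE; case: ifPn => // /negP x0.
  apply: integral0_eq => t _ /=.
  rewrite (_ : (_ <= 0) = false) ?andbF//.
  apply/negbTE; rewrite -ltNge ltr_pwDl//.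
    rewrite mulr_gt0// exprn_even_gt0//=; apply/eqP => x0'.
    by apply: x0; rewrite inE.
  by rewrite sumr_ge0// => y _; exact: sqr_ge0.
exact: integral_set1.
Qed.

(** [u] holds the coordinates of a candidate index set and [v] the others. The first three
    conditions say that the candidate is the set of coordinates above the threshold, the last one
    bounds the squared distance to the simplex. *)
Definition steiner_piece (rho : R) (u v : seq R) : \bar R :=
  iverson [&& (0 < size u)%N, all (fun y => level u < y) u,
              all (fun y => y <= level u) v &
              (size u)%:R * level u ^+ 2 + \sum_(y <- v) y ^+ 2 <= rho].

Lemma steiner_pieceE rho u v i : size u = i.+1 ->
  (steiner_piece rho u v = iverson (all (fun y => level u < y)%R u) *
     iverson (in_cone_ball i rho (level u :: v)))%E.
Proof. by move=> su; rewrite -iverson_and /= -su /steiner_piece su. Qed.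

Lemma seq_measurable_steiner_piece rho :
  seq_measurable (steiner_piece rho : seq T -> seq T -> \bar R).
Proof.
move=> [|i] m.
  rewrite (_ : (fun _ => _) = cst 0%E); first exact: measurable_cst.
  by apply/funext => -[u v]; rewrite (tuple0 u) /steiner_piece.
rewrite (_ : (fun _ => _) = fun p : i.+1.-tuple T * m.-tuple T =>
  (iverson (all (fun y => level p.1 < y)%R p.1) *
     iverson (in_cone_ball i rho (tcons (level p.1 : T, p.2))))%E); last first.
  by apply/funext => -[u v]; rewrite (@steiner_pieceE _ _ _ i) ?size_tuple.
have mc : measurable_fun setT (fun p : i.+1.-tuple T * m.-tuple T => level p.1).
  exact: (measurableT_comp (measurable_level (n := i.+1)) measurable_fst).
apply: emeasurable_funM; apply: measurable_iverson.
  apply: (measurable_all_tuple (h := fun (p : i.+1.-tuple T * m.-tuple T) y => level p.1 < y) (g := fst)) => //.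
  apply: measurable_fun_ltr => //.
  exact: (measurableT_comp mc measurable_fst).
apply: (measurable_in_cone_ball _ (f := cst rho) (g := fun p : i.+1.-tuple T * m.-tuple T => tcons (level p.1 : T, p.2))) => //.
exact: (measurable_cons mc measurable_snd).
Qed.

(** The integral over [v] depends on [u] through its level alone, so [integral_level] applies to
    it. *)
Lemma double_integral_steiner_piece rho i m :
  double_integral mu (steiner_piece rho) i.+1 m =
  ((i.+1%:R / i`!%:R)%:E * cone_volume i m rho)%E.
Proof.
have mK : measurable_fun setT (fun p : R * m.-tuple T => iverson (in_cone_ball i rho (p.1 :: p.2)) : \bar R).
  apply: measurable_iverson.
  by apply: (measurable_in_cone_ball _ (f := cst rho) (g := fun p => tcons (p.1 : T, p.2))) => //; exact: measurable_tcons.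
rewrite /cone_volume integral_tuple_powerS//; last exact: measurable_iverson_cone_ball.
rewrite -(integral_level _ (h := fun l => \int[leb m]_v iverson (in_cone_ball i rho (l :: v)))%E); last 2 first.
- exact: (measurable_fun_fubini_tonelli_F (m2 := leb m) (fun p => iverson (in_cone_ball i rho (p.1 :: p.2)))).
- by move=> x; exact: integral_ge0.
apply: eq_integral => u _.
rewrite -ge0_integralZl_EFin//; last first.
  exact: (measurableT_comp mK (pair1_measurable (level u))).
by apply: eq_integral => v _; rewrite (@steiner_pieceE _ _ _ i) ?size_tuple.
Qed.

Lemma double_integral_steiner_piece0 rho m :
  double_integral mu (steiner_piece rho) 0 m = 0%E.
Proof.
rewrite /double_integral integral_tuple_power0//; last first.
  by move=> t; apply: integral_ge0 => v _; exact: iverson_ge0.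
exact: integral0_eq.
Qed.

End steiner_pieces.

(** * The standard normal density and distribution function *)

Section std_normal.
Context {R : realType}.
Local Notation mu := (@lebesgue_measure R).
Local Notation T := (measurableTypeR R).
Implicit Types x : R.

Definition std_pdf x : R := normal_pdf 0 1 x.

Lemma std_pdfE x : std_pdf x = (Num.sqrt (pi *+ 2))^-1 * expR (- (x ^+ 2 / 2)).
Proof.
rewrite /std_pdf normal_pdfE ?oner_eq0// /normal_peak /normal_fun.
by rewrite expr1n mul1r subr0 mulNr.
Qed.

Lemma sqrt2pi_gt0 : 0 < Num.sqrt (pi *+ 2) :> R.
Proof. by rewrite sqrtr_gt0 mulrn_wgt0// pi_gt0. Qed.

Lemma std_pdf_ge0 x : 0 <= std_pdf x. Proof. exact: normal_pdf_ge0. Qed.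

Lemma std_pdf_le1 x : std_pdf x <= 1.
Proof.
rewrite std_pdfE -[leRHS]mulr1 ler_pM// ?invr_ge0 ?sqrtr_ge0 ?expR_ge0//.
  rewrite invf_le1 ?sqrt2pi_gt0// -[leLHS]sqrtr1 ler_wsqrtr//.
  by rewrite -mulr_natr; have := pi_ge2 R; lra.
by rewrite -[leRHS]expR0 ler_expR oppr_le0 divr_ge0// sqr_ge0.
Qed.

Lemma continuous_std_pdf : continuous std_pdf.
Proof. by apply: continuous_normal_pdf; rewrite oner_eq0. Qed.

Lemma measurable_std_pdf : measurable_fun setT std_pdf.
Proof. exact: measurable_normal_pdf. Qed.

Lemma is_derive_std_pdf x : is_derive x (1 : R) std_pdf (- x * std_pdf x).
Proof.
pose h : R -> R := (- 2^-1) \*: (id ^+ 2).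
have dh : is_derive x (1 : R) h (- x).
  apply: is_derive_eq; rewrite /GRing.scale/= expr1 mulr1 mulrA.
  by rewrite mulNr mulVf// mulN1r.
have -> : std_pdf = (Num.sqrt (pi *+ 2))^-1 \*: (expR \o h).
  apply/funext => y; rewrite std_pdfE; congr (_ * expR _).
  by rewrite /h !fctE -[RHS]/(- 2^-1 * y ^+ 2) mulNr mulrC.
apply: is_derive_eq.
rewrite -[LHS]/((Num.sqrt (pi *+ 2))^-1 * (expR (h x) * - x)).
rewrite -[RHS]/(- x * ((Num.sqrt (pi *+ 2))^-1 * expR (h x))).
by ring.
Qed.

Definition std_cdf x : R := fine (normal_prob 0 1 `]-oo, x]%classic).

Lemma normal_prob_itvNy x : normal_prob 0 1 `]-oo, x]%classic = (std_cdf x)%:E.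
Proof. by rewrite /std_cdf fineK// fin_num_measure. Qed.

Lemma std_cdf_ge0 x : 0 <= std_cdf x.
Proof. exact: fine_ge0. Qed.

Lemma std_cdf_le1 x : std_cdf x <= 1.
Proof. by rewrite -lee_fin -normal_prob_itvNy probability_le1. Qed.

Lemma is_derive_std_cdf x : is_derive x (1 : R) std_cdf (std_pdf x).
Proof.
have [] := @continuous_FTC1 R std_pdf -oo%O x (x + 1) _ _ _ _.
- by rewrite ltrDl.
- apply: (integrableS _ _ (@subsetT _ _)) => //.
  exact: integrable_normal_pdf.
- by rewrite ltNyr.
- exact: continuous_std_pdf.
move=> df <-; rewrite derive1E; exact: DeriveDef.
Qed.

Lemma continuous_std_cdf : continuous std_cdf.
Proof.
move=> x; apply/differentiable_continuous; apply/derivable1_diffP.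
by have [] := is_derive_std_cdf x.
Qed.

Lemma measurable_std_cdf : measurable_fun setT std_cdf.
Proof. exact: (continuous_measurable_fun continuous_std_cdf). Qed.

(** Layer-cake argument: f(x) is the length of [0, f(x)[, and Tonelli reduces the claim to the
    normal probability of the sets where f exceeds y. *)
Lemma ge0_integral_normal_prob (f : R -> R) :
  measurable_fun setT f -> (forall x, 0 <= f x) ->
  (\int[normal_prob 0 1]_x (f x)%:E = \int[mu]_x (f x * std_pdf x)%:E)%E.
Proof.
move=> mf f0.
pose b (p : T * T) := (0 <= p.2) && (p.2 < f p.1).
have mb : measurable_fun setT b.
  apply: measurable_and; first exact: measurable_fun_ler.
  by apply: measurable_fun_ltr => //; exact: measurableT_comp.
have layer x : (\int[mu]_y iverson (b (x, y)))%E = (f x)%:E.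
  rewrite integral_iverson; last exact: (measurableT_comp mb (pair1_measurable x)).
  rewrite (_ : [set z | _] = `[0, f x[%classic); last first.
    by apply/seteqP; split => y /=; rewrite /b/= in_itv.
  rewrite /= lebesgue_measure_itv/= lte_fin; have := f0 x.
  by rewrite le_eqVlt => /predU1P[<-|->]; rewrite ?ltxx// oppr0 adde0.
have mi : measurable_fun setT (fun p => iverson (b p) : \bar R).
  exact: measurable_iverson.
transitivity (\int[normal_prob 0 1]_x \int[mu]_y iverson (b (x, y)))%E.
  by apply: eq_integral => x _; rewrite layer.
rewrite (fubini_tonelli (m1 := normal_prob 0 1) (m2 := mu) (fun p => iverson (b p)))//.
transitivity (\int[mu]_y \int[mu]_x (iverson (b (x, y)) * (std_pdf x)%:E))%E.
  apply: eq_integral => y _.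
  rewrite integral_iverson; last exact: (measurableT_comp mb (pair2_measurable y)).
  (* The probability of a set is by definition the integral of the density over it. *)
  transitivity (\int[mu]_(x in [set z | b (z, y)]) (std_pdf x)%:E)%E; first by [].
  rewrite integral_mkcond; apply: eq_integral => x _.
  rewrite patchE /iverson; have [h|h] := boolP (b (x, y)).
    by rewrite mem_set// mul1e.
  by rewrite memNset ?mul0e//; exact/negP.
have mp : measurable_fun setT (fun p : T * T => (std_pdf p.1)%:E).
  by apply/measurable_EFinP/(measurableT_comp measurable_std_pdf).
rewrite -(fubini_tonelli (m1 := mu) (m2 := mu)
  (fun p => (iverson (b p) * (std_pdf p.1)%:E)%E))//; last 2 first.
- exact: emeasurable_funM.
- by move=> p; rewrite mule_ge0// lee_fin std_pdf_ge0.
apply: eq_integral => x _.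
rewrite /= ge0_integralZr ?lee_fin ?std_pdf_ge0//; last first.
  exact: (measurableT_comp mi (pair1_measurable x)).
by rewrite layer.
Qed.

Lemma integral_normal_prob (f : R -> R) :
  measurable_fun setT f ->
  (\int[normal_prob 0 1]_x (f x)%:E = \int[mu]_x (f x * std_pdf x)%:E)%E.
Proof.
move=> mf; rewrite integralE [RHS]integralE; congr (_ - _)%E.
  transitivity (\int[normal_prob 0 1]_x (Num.max (f x) 0)%:E)%E.
    by apply: eq_integral => x _; rewrite funeposE EFin_max.
  rewrite ge0_integral_normal_prob//; last 2 first.
  - exact: measurable_maxr.
  - by move=> x; rewrite le_max lexx orbT.
  apply: eq_integral => x _.
  by rewrite funeposE maxr_pMl ?std_pdf_ge0// mul0r EFin_max.
transitivity (\int[normal_prob 0 1]_x (Num.max (- f x) 0)%:E)%E.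
  by apply: eq_integral => x _; rewrite funenegE EFin_max.
rewrite ge0_integral_normal_prob//; last 2 first.
- by apply: measurable_maxr => //; exact: measurableT_comp.
- by move=> x; rewrite le_max lexx orbT.
apply: eq_integral => x _.
by rewrite funenegE maxr_pMl ?std_pdf_ge0// mul0r EFin_max mulNr.
Qed.

(** Domination by exp (- x^2 / 4), a multiple of the normal density of variance 2: the other half of
    the exponent absorbs |x|, as exp (x^2 / 4) >= 1 + x^2 / 4 >= |x|. *)
Lemma integrable_xstd_pdf :
  mu.-integrable setT (fun x => (x * std_pdf x)%:E).
Proof.
have s0 : Num.sqrt 2 != 0 :> R by rewrite gt_eqF// sqrtr_gt0.
pose c : R := (normal_peak (Num.sqrt 2))^-1.
have ic : mu.-integrable setT (fun x => (c * normal_pdf 0 (Num.sqrt 2) x)%:E).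
  under eq_fun do rewrite EFinM.
  by apply: integrableZl => //; exact: integrable_normal_pdf.
apply: (le_integrable measurableT _ _ ic).
- apply/measurable_EFinP; apply: measurable_funM => //.
  exact: measurable_std_pdf.
- move=> x _; rewrite lee_fin normrM (ger0_norm (std_pdf_ge0 x)).
  rewrite (@ger0_norm _ (c * _)); last first.
    by rewrite mulr_ge0 ?normal_pdf_ge0// invr_ge0 normal_peak_ge0.
  rewrite normal_pdfE// /c mulKf; last by rewrite gt_eqF// normal_peak_gt0.
  rewrite /normal_fun subr0 sqr_sqrtr// mulNr.
  apply: (@le_trans _ _ (`|x| * expR (- (x ^+ 2 / 2)))).
    rewrite ler_wpM2l// std_pdfE ler_piMl ?expR_ge0// invf_le1 ?sqrt2pi_gt0//.
    rewrite -[leLHS]sqrtr1 ler_wsqrtr// -mulr_natr; have := pi_ge2 R; lra.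
  have -> : - (x ^+ 2 / 2) = - (x ^+ 2 / (2 *+ 2)) + - (x ^+ 2 / 4) :> R by lra.
  rewrite expRD mulrCA ler_piMr ?expR_ge0// expRN ler_pdivrMr ?expR_gt0// mul1r.
  apply: le_trans (expR_ge1Dx _).
  rewrite -real_normK ?num_real//; have := sqr_ge0 (`|x| / 2 - 1); nra.
Qed.

Lemma integral_pdf_cdf_fin k m :
  (\int[mu]_x (std_pdf x ^+ k.+1 * std_cdf x ^+ m)%:E)%E \is a fin_num.
Proof.
apply: integrable_fin_num => //.
have mkm : measurable_fun setT (fun x => std_pdf x ^+ k.+1 * std_cdf x ^+ m).
  apply: measurable_funM; apply: measurable_funX.
    exact: measurable_std_pdf.
  exact: measurable_std_cdf.
apply: (le_integrable measurableT _ _ (integrable_normal_pdf 0 1)).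
- exact/measurable_EFinP.
- move=> x _; rewrite lee_fin !ger0_norm ?mulr_ge0 ?exprn_ge0 ?std_pdf_ge0 ?std_cdf_ge0//.
  rewrite exprS -mulrA ler_piMr ?std_pdf_ge0// mulr_ile1 ?exprn_ge0 ?std_pdf_ge0 ?std_cdf_ge0//.
    by rewrite exprn_ile1 ?std_pdf_ge0 ?std_pdf_le1.
  by rewrite exprn_ile1 ?std_cdf_ge0 ?std_cdf_le1.
Qed.

End std_normal.

(** * Cone volumes as Gaussian integrals *)

Section laplace.
Context {R : realType}.
Local Notation mu := (@lebesgue_measure R).
Local Notation T := (measurableTypeR R).
Local Notation leb := (tuple_power mu).
Local Notation sqrt2pi := (Num.sqrt (pi *+ 2) : R).

Lemma expR_std_pdf (y : R) : expR (- (y ^+ 2 / 2)) = sqrt2pi * std_pdf y.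
Proof. by rewrite std_pdfE mulVKf// gt_eqF// sqrt2pi_gt0. Qed.

Definition gaussian_cone i (t : seq R) : R :=
  if t is l :: v then (all (fun y => y <= l) v)%:R *
    expR (- ((i.+1%:R * l ^+ 2 + \sum_(y <- v) y ^+ 2) / 2))
  else 0.

Lemma gaussian_cone_ge0 i t : 0 <= gaussian_cone i t.
Proof. by case: t => //= l v; rewrite mulr_ge0 ?expR_ge0. Qed.

(** Once the head is fixed the integrand is a product over the tail, so its integral is a power of a
    one-dimensional one; the weight [i.+1] becomes an exponent. *)
Lemma gaussian_cone_prod i l (v : seq R) :
  gaussian_cone i (l :: v) = expR (- (l ^+ 2 / 2)) ^+ i.+1 *
    \prod_(y <- v) ((y <= l)%R%:R * expR (- (y ^+ 2 / 2))).
Proof.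
have -> : expR (- (l ^+ 2 / 2)) ^+ i.+1 = expR (- ((i.+1%:R * l ^+ 2) / 2)).
  by rewrite -expRM_natl; congr expR; rewrite mulrN mulrA.
rewrite /gaussian_cone; elim: v => [|y v IH] /=.
  by rewrite !big_nil addr0 mul1r mulr1.
rewrite !big_cons; move: IH.
set P := \prod_(_ <- _) _; set S := \sum_(_ <- _) _ => IH.
rewrite [RHS]mulrCA -IH mulrACA -natrM mulnb -expRD; congr (_ * expR _).
by lra.
Qed.

Lemma measurable_gaussian_cone i m :
  measurable_fun setT (fun t : m.+1.-tuple T => gaussian_cone i t).
Proof.
have m2 : measurable_fun setT (fun y : R => expR (- (y ^+ 2 / 2))).
  apply: measurableT_comp => //; apply: measurableT_comp => //.
  by apply: measurable_funM => //; exact: measurable_funX.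
pose f (y : R * T) := (y.2 <= y.1)%R%:R * expR (- (y.2 ^+ 2 / 2)) : R.
rewrite (_ : (fun _ => _) = fun t : m.+1.-tuple T =>
  expR (- (thead t ^+ 2 / 2)) ^+ i.+1 * \prod_(j < m) f (thead t, tnth [tuple of behead t] j)); last first.
  apply/funext => t; rewrite {1}(tuple_eta t) gaussian_cone_prod; congr (_ * _).
  by rewrite big_tuple.
have mh : measurable_fun setT (fun t : m.+1.-tuple T => thead t).
  exact: measurable_tnth.
apply: measurable_funM.
  by apply: measurable_funX; exact: (measurableT_comp m2 mh).
apply: measurable_prod => j _.
have mf : measurable_fun setT f.
  apply: measurable_funM; last exact: (measurableT_comp m2 measurable_snd).
  rewrite (_ : (fun _ => _) = fun x : R * T => if x.2 <= x.1 then 1 else 0); last first.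
    by apply/funext => x; case: ifP.
  by apply: measurable_fun_ifT => //; exact: measurable_fun_ler.
apply: (measurableT_comp mf); apply: measurable_fun_pair => //.
exact: (measurableT_comp (measurable_tnth j) (@measurable_behead _ T m)).
Qed.

Lemma integral_below_std_pdf (l : R) :
  (\int[mu]_y ((y <= l)%R%:R * expR (- (y ^+ 2 / 2)))%:E =
   (sqrt2pi * std_cdf l)%:E)%E.
Proof.
rewrite EFinM -normal_prob_itvNy.
transitivity (sqrt2pi%:E * \int[mu]_(y in `]-oo, l]) (std_pdf y)%:E)%E; last by [].
rewrite [in RHS]integral_mkcond -ge0_integralZl_EFin ?sqrtr_ge0//; last 2 first.
- by move=> y _; rewrite patchE; case: ifP => // _; rewrite lee_fin std_pdf_ge0.
- apply/(measurable_restrictT _ _).1 => //; apply/measurable_funTS.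
  by apply/measurable_EFinP; exact: measurable_std_pdf.
apply: eq_integral => y _; rewrite patchE mem_setE in_itv/= expR_std_pdf.
by case: ifP => _; [rewrite mul1r EFinM|rewrite mul0r mule0].
Qed.

(** Direct evaluation: for a fixed head x, the head contributes (sqrt (2 pi) phi(x))^(i+1) and each
    of the m other coordinates sqrt (2 pi) Phi(x). *)
Lemma integral_gaussian_cone i m :
  (\int[leb m.+1]_t (gaussian_cone i t)%:E =
   (sqrt2pi ^+ (m + i.+1))%:E *
   \int[mu]_x (std_pdf x ^+ i.+1 * std_cdf x ^+ m)%:E)%E.
Proof.
rewrite integral_tuple_powerS; last 2 first.
- by apply/measurable_EFinP; exact: measurable_gaussian_cone.
- by move=> t; rewrite lee_fin gaussian_cone_ge0.
rewrite -[RHS]ge0_integralZl_EFin//; last 2 first.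
- by move=> x _; rewrite lee_fin mulr_ge0// exprn_ge0 ?std_pdf_ge0 ?std_cdf_ge0.
- apply/measurable_EFinP/measurable_funM; apply: measurable_funX.
    exact: measurable_std_pdf.
  exact: measurable_std_cdf.
apply: eq_integral => l _.
have mg : measurable_fun setT (fun y : T => (y <= l)%R%:R * expR (- (y ^+ 2 / 2)) : R).
  apply: measurable_funM.
    rewrite (_ : (fun _ => _) = fun x : T => if x <= l then 1 else 0 : R); last first.
      by apply/funext => x; case: ifP.
    by apply: measurable_fun_ifT => //; exact: measurable_fun_ler.
  apply: measurableT_comp => //; apply: measurableT_comp => //.
  by apply: measurable_funM => //; exact: measurable_funX.
have g0 (y : R) : 0 <= (y <= l)%R%:R * expR (- (y ^+ 2 / 2)).
  by rewrite mulr_ge0 ?expR_ge0.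
transitivity (\int[leb m]_t ((expR (- (l ^+ 2 / 2)) ^+ i.+1)%:E *
    (\prod_(y <- t) ((y <= l)%R%:R * expR (- (y ^+ 2 / 2))))%:E))%E.
  by apply: eq_integral => t _; rewrite -EFinM -gaussian_cone_prod.
rewrite ge0_integralZl_EFin ?exprn_ge0 ?expR_ge0//; last 2 first.
- by move=> t _; rewrite lee_fin prodr_ge0.
- by apply/measurable_EFinP; exact: measurable_prod_tuple.
rewrite (integral_prod_tuple m mg g0 (integral_below_std_pdf l)) -!EFinM.
congr EFin; rewrite expR_std_pdf !exprMn exprD.
by rewrite mulrACA; congr (_ * _); rewrite mulrC.
Qed.

(** Writes an exponential as an integral of indicators of half-lines, for use under Tonelli. The
    condition [0 < s] records the range of the outer integral and only matters for [a = 0]. *)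
Lemma integral_expR_above (a : R) : 0 <= a ->
  (\int[mu]_s (((0 < s) && (a <= s))%:R * expR (- s))%:E = (expR (- a))%:E)%E.
Proof.
move=> a0.
have cE : continuous (fun s : R => expR (- s)).
  by move=> s; apply: (cvg_comp (fun s => - s) expR); [apply: cvgN; exact: cvg_id|exact: continuous_expR].
have dF (x : R) : is_derive x (1 : R) (fun s => - expR (- s)) (expR (- x)).
  have -> : (fun s : R => - expR (- s)) = - (expR \o -%R) by [].
  by apply: is_derive_eq; rewrite mulrN1 opprK.
transitivity (\int[mu]_(s in `[a, +oo[) (expR (- s))%:E)%E; last first.
  rewrite (ge0_continuous_FTC2y (F := fun s => - expR (- s)) (l := 0)).
  - by rewrite sub0e EFinN oppeK.
  - by move=> x _; exact: expR_ge0.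
  - exact: continuous_subspaceT.
  - by rewrite -oppr0; apply: cvgN; exact: cvgr_expR.
  - by move=> x _; have [] := dF x.
  - apply: cvg_at_right_filter; apply: cvgN; exact: cE.
  - by move=> x _; rewrite derive1E; exact: derive_val.
rewrite -integral_itv_obnd_cbnd; last first.
  by apply/measurable_EFinP/measurable_funTS; exact: continuous_measurable_fun.
have [->|an0] := eqVneq a 0.
  rewrite [RHS]integral_mkcond; apply: eq_integral => x _.
  rewrite patchE mem_setE in_itv/= andbT; have [x0|_] := ltP 0 x.
    by rewrite (ltW x0) mul1r.
  by rewrite mul0r.
have a1 : 0 < a by rewrite lt_neqAle eq_sym an0.
rewrite integral_itv_obnd_cbnd; last first.
  by apply/measurable_EFinP/measurable_funTS; exact: continuous_measurable_fun.
rewrite [RHS]integral_mkcond; apply: eq_integral => x _.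
rewrite patchE mem_setE in_itv/= andbT; have [ax|_] := leP a x.
  by rewrite (lt_le_trans a1 ax) mul1r.
by rewrite andbF mul0r.
Qed.

(** Evaluation by level sets: with Q the quadratic form, exp (- Q / 2) is the integral of exp (- s)
    over s >= Q / 2, and Q <= 2 s on the cone defines the section of squared radius 2 s. *)
Lemma laplace_cone_volume i m :
  (\int[mu]_(s in `]0%R, +oo[) ((expR (- s))%:E * cone_volume i m (2 * s)) =
   \int[leb m.+1]_t (gaussian_cone i t)%:E)%E.
Proof.
pose H (p : T * m.+1.-tuple T) : \bar R :=
  (((0 < p.1)%R%:R * expR (- p.1))%:E * iverson (in_cone_ball i (2 * p.1) p.2))%E.
have me : measurable_fun setT (fun x : T => (0 < x)%R%:R * expR (- x) : R).
  apply: measurable_funM.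
    rewrite (_ : (fun _ => _) = fun x : T => if 0 < x then 1 else 0 : R); last first.
      by apply/funext => x; case: ifP.
    by apply: measurable_fun_ifT => //; exact: measurable_fun_ltr.
  by apply: measurableT_comp => //; exact: measurableT_comp.
have e0 (x : R) : 0 <= (0 < x)%R%:R * expR (- x) by rewrite mulr_ge0 ?expR_ge0.
have mH : measurable_fun setT H.
  apply: emeasurable_funM.
    apply/measurable_EFinP; exact: (measurableT_comp me measurable_fst).
  apply/measurable_iverson/measurable_in_cone_ball => //.
  exact: measurable_funM.
have H0 p : (0 <= H p)%E by rewrite mule_ge0.
transitivity (\int[mu]_s \int[leb m.+1]_t H (s, t))%E.
  rewrite integral_mkcond; apply: eq_integral => s _.
  rewrite /H/= ge0_integralZl_EFin//; last exact: measurable_iverson_cone_ball.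
  rewrite patchE mem_setE in_itv/= andbT.
  by case: ifP => _; rewrite ?mul1r// mul0r mul0e.
rewrite (fubini_tonelli (m1 := mu) (m2 := leb m.+1) H)//.
apply: eq_integral => t _.
case/tupleP: t => l v /=.
set Q := i.+1%:R * l ^+ 2 + \sum_(y <- v) y ^+ 2.
have Q0 : 0 <= Q / 2.
  rewrite divr_ge0// addr_ge0//; first by rewrite mulr_ge0 ?sqr_ge0.
  by apply: sumr_ge0 => y _; exact: sqr_ge0.
transitivity (\int[mu]_s ((all (fun y => y <= l)%R v)%:R%:E *
    (((0 < s) && (Q / 2 <= s))%:R * expR (- s))%:E))%E.
  apply: eq_integral => s _; rewrite /H/= -/Q /iverson -!EFinM; congr EFin.
  rewrite ler_pdivrMr// [s * 2]mulrC -!mulnb !natrM.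
  by ring.
rewrite ge0_integralZl_EFin//.
- by rewrite integral_expR_above.
- apply/measurable_EFinP; apply: measurable_funM.
    rewrite (_ : (fun _ => _) = fun x : T => if (0 < x) && (Q / 2 <= x) then 1 else 0 : R); last first.
      by apply/funext => x; case: ifP.
    apply: measurable_fun_ifT => //; apply: measurable_and.
      exact: measurable_fun_ltr.
    exact: measurable_fun_ler.
  by apply: measurableT_comp => //; exact: measurableT_comp.
Qed.

End laplace.

(** * Gamma at half-integers, positivity of kappa, and the volume of the unit cone section *)

Section gamma.
Context {R : realType}.
Local Notation mu := (@lebesgue_measure R).
Local Notation T := (measurableTypeR R).
Local Notation sqrt2pi := (Num.sqrt (pi *+ 2) : R).

Lemma powR_half (a : R) n : 0 <= a -> a `^ (n%:R / 2) = Num.sqrt a ^+ n.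
Proof.
by move=> a0; rewrite mulrC powRrM powR12_sqrt// powR_mulrn// sqrtr_ge0.
Qed.

(** Gamma(n / 2 + 1) before its truncation to a real number, so that finiteness can be stated. *)
Definition gamma_half n : \bar R :=
  (\int[mu]_(t in `]0%R, +oo[) (t `^ (n%:R / 2) * expR (- t))%:E)%E.

Lemma Gamma_half n : Gamma (n%:R / 2 + 1) = fine (gamma_half n).
Proof. by rewrite /Gamma addrK. Qed.

Lemma measurable_gamma n D :
  measurable_fun D (fun t : R => (t `^ (n%:R / 2) * expR (- t))%:E).
Proof.
apply/measurable_funTS/measurable_EFinP/measurable_funM.
  exact: measurable_powR.
by apply: measurableT_comp => //; exact: measurableT_comp.
Qed.

Lemma integral_expR_half :
  (\int[mu]_(s in `]0%R, +oo[) (expR (- (s / 2)))%:E = 2%:E)%E.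
Proof.
have me : measurable_fun setT (fun s : R => (((0 < s) && (0 <= s))%:R * expR (- s))%:E).
  apply/measurable_EFinP/measurable_funM.
    rewrite (_ : (fun _ => _) = fun x : T => if (0 < x) && (0 <= x) then 1 else 0 : R); last first.
      by apply/funext => x; case: ifP.
    apply: measurable_fun_ifT => //; apply: measurable_and.
      exact: measurable_fun_ltr.
    exact: measurable_fun_ler.
  by apply: measurableT_comp => //; exact: measurableT_comp.
have e0 (x : R) : (0 <= (((0 < x) && (0 <= x))%:R * expR (- x))%:E)%E.
  by rewrite lee_fin mulr_ge0 ?expR_ge0.
have h2 : 0 < 2^-1 :> R by rewrite invr_gt0.
have := integral_expR_above (lexx (0 : R)).
rewrite (lebesgue_integral_affine 0 h2 me e0) oppr0 expR0.
rewrite (_ : (\int[_]_x _)%E = (\int[mu]_(s in `]0%R, +oo[) (expR (- (s / 2)))%:E)%E).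
  move=> h; rewrite -[LHS]mul1e -(_ : (2%:E * (2^-1)%:E = 1)%E).
    by rewrite -muleA h mule1.
  by rewrite -EFinM mulfV.
rewrite [RHS]integral_mkcond; apply: eq_integral => x _.
rewrite patchE mem_setE in_itv/= andbT addr0 pmulr_rgt0// [2^-1 * _]mulrC.
have [x0|_] := ltP 0 x; last by rewrite mul0r.
by rewrite divr_ge0 ?(ltW x0)// mul1r.
Qed.

Lemma gamma_half_fin n : gamma_half n.+1 \is a fin_num.
Proof.
(* With x = (1 + t) / 2, sqrt t <= 2 x and x^(n+1) <= (n+1)! exp x; the factor exp (t / 2) then
   leaves exp (- t / 2) of the exponential. *)
pose C : R := 2 ^+ n.+1 * n.+1`!%:R * expR 2^-1.
rewrite ge0_fin_numE; last first.
  by apply: integral_ge0 => t _; rewrite lee_fin mulr_ge0 ?powR_ge0 ?expR_ge0.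
apply: (@le_lt_trans _ _ (\int[mu]_(t in `]0%R, +oo[) (C%:E * (expR (- (t / 2)))%:E))%E).
  apply: ge0_le_integral => //.
  - by move=> t _; rewrite lee_fin mulr_ge0 ?powR_ge0 ?expR_ge0.
  - exact: measurable_gamma.
  - apply/measurable_funTS/measurable_EFinP/measurable_funM => //.
    apply: measurableT_comp => //; apply: measurableT_comp => //.
    exact: measurable_funM.
  move=> t; rewrite /= in_itv/= andbT => t0.
  rewrite -EFinM lee_fin powR_half; last exact: ltW.
  have -> : - t = - (t / 2) + - (t / 2) by lra.
  rewrite expRD mulrA ler_wpM2r ?expR_ge0// expRN ler_pdivrMr ?expR_gt0//.
  rewrite /C -[_ * expR _ * expR _]mulrA -expRD.
  have x0 : 0 <= 2^-1 + t / 2 by rewrite addr_ge0// divr_ge0// ltW.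
  have s2 : Num.sqrt t <= 2 * (2^-1 + t / 2).
    rewrite -(@ler_pXn2r _ 2)// ?nnegrE ?sqrtr_ge0//; last by rewrite mulr_ge0.
    rewrite sqr_sqrtr; last exact: ltW.
    by nra.
  apply: (@le_trans _ _ ((2 * (2^-1 + t / 2)) ^+ n.+1)).
    by rewrite ler_pXn2r// nnegrE ?sqrtr_ge0// mulr_ge0.
  rewrite exprMn -mulrA ler_pM2l ?exprn_gt0//.
  rewrite -ler_pdivrMl ?ltr0n ?fact_gt0// mulrC.
  by apply: le_trans (expR_ge1Dxn n x0); rewrite lerDr.
rewrite ge0_integralZl_EFin//.
- by rewrite integral_expR_half -EFinM ltry.
- apply/measurable_funTS/measurable_EFinP; apply: measurableT_comp => //.
  by apply: measurableT_comp => //; exact: measurable_funM.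
- by rewrite /C !mulr_ge0 ?exprn_ge0 ?expR_ge0.
Qed.

Lemma gamma_half_gt0 n : (0 < gamma_half n)%E.
Proof.
(* On [1, 2] the power is at least 1 and the exponential at least exp (- 2). *)
apply: (@lt_le_trans _ _ (\int[mu]_(t in `[1%R, 2%R]) (cst (expR (- 2))%:E t))%E).
  rewrite integral_cst//= lebesgue_measure_itv/= lte_fin ltr1n/=.
  by rewrite -EFinD -EFinM lte_fin mulr_gt0 ?expR_gt0//; lra.
apply: (@le_trans _ _ (\int[mu]_(t in `[1%R, 2%R]) (t `^ (n%:R / 2) * expR (- t))%:E)%E).
  apply: ge0_le_integral => //.
  - by move=> t _; rewrite lee_fin expR_ge0.
  - exact: measurable_gamma.
  move=> t; rewrite /= in_itv/= => /andP[t1 t2].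
  rewrite lee_fin -[leLHS]mul1r ler_pM ?expR_ge0//; last by rewrite ler_expR lerN2.
  have p0 : (0 : R) <= n%:R / 2 by rewrite divr_ge0.
  by have := ler_powR t1 p0; rewrite powRr0.
apply: ge0_subset_integral => //.
- exact: measurable_gamma.
- by move=> t _; rewrite lee_fin mulr_ge0 ?powR_ge0 ?expR_ge0.
- by apply: subset_itv; rewrite bnd_simp.
Qed.

(** Allows kappa_(n-k) with k < n to be cancelled when Steiner coefficients are compared. *)
Lemma kappa_gt0 n : 0 < kappa R n.+1.
Proof.
rewrite /kappa Gamma_half divr_gt0//; first by rewrite powR_gt0// pi_gt0.
by rewrite fine_gt0// gamma_half_gt0 ltey_eq gamma_half_fin.
Qed.

Definition pdf_cdf_integral k m : R :=
  fine (\int[mu]_x (std_pdf x ^+ k.+1 * std_cdf x ^+ m)%:E)%E.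

(** By homogeneity the level-set evaluation is 2^((m+1)/2) Gamma((m+1)/2 + 1) times the unknown
    volume. Equating it with the direct one, (2 pi)^((m+i+1)/2) times [pdf_cdf_integral i m], leaves
    kappa_(m+1) (2 pi)^(i/2). *)
Lemma cone_volume1E i m : cone_volume i m (1 : R) =
  (kappa R m.+1 * (2 * pi) `^ (i%:R / 2) * pdf_cdf_integral i m)%:E.
Proof.
have pi0 := pi_gt0 R.
have pp : 0 <= 2 * pi :> R by rewrite mulr_ge0// ltW.
have c0 : (0 <= cone_volume i m (1 : R))%E by exact: integral_ge0.
have key : (((2 : R) `^ (m.+1%:R / 2))%:E * gamma_half m.+1 * cone_volume i m (1 : R) =
   (sqrt2pi ^+ (m + i.+1) * pdf_cdf_integral i m)%:E)%E.
  rewrite EFinM /pdf_cdf_integral fineK ?integral_pdf_cdf_fin//.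
  rewrite -integral_gaussian_cone -laplace_cone_volume.
  rewrite -ge0_integralZl_EFin ?powR_ge0//; last 2 first.
  - by move=> t _; rewrite lee_fin mulr_ge0 ?powR_ge0 ?expR_ge0.
  - exact: measurable_gamma.
  transitivity (\int[mu]_(t in `]0%R, +oo[) (((2 : R) `^ (m.+1%:R / 2))%:E *
      (t `^ (m.+1%:R / 2) * expR (- t))%:E * cone_volume i m (1 : R)))%E.
    apply/esym; rewrite ge0_integralZr//.
    - by apply/measurable_funeM; exact: measurable_gamma.
    - by move=> t _; rewrite mule_ge0// lee_fin ?mulr_ge0 ?powR_ge0 ?expR_ge0.
  apply: eq_integral => t; rewrite inE/= in_itv/= andbT => t0.
  have t2 : 0 < 2 * t by rewrite mulr_gt0.
  (* Scaling is stated for squared radii, so the factor is the square root of 2 t. *)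
  rewrite -[2 * t]sqr_sqrtr; last exact: ltW.
  rewrite cone_volume_scale ?sqrtr_gt0// muleA; congr (_ * _)%E.
  rewrite -!EFinM; congr EFin.
  rewrite -powR_half; last exact: ltW.
  by rewrite powRM ?(ltW t0)//; ring.
have G0 := gamma_half_gt0 m.+1; have Gf := gamma_half_fin m.
have g0 : 0 < fine (gamma_half m.+1) by rewrite fine_gt0// G0 ltey_eq Gf.
have p2 : 0 < (2 : R) `^ (m.+1%:R / 2) by rewrite powR_gt0.
(* Finiteness comes from the identity itself: an infinite volume times a positive factor could not
   equal a real number. *)
have cf : cone_volume i m (1 : R) \is a fin_num.
  rewrite ge0_fin_numE// ltey; apply/eqP => coo; move: key.
  rewrite coo gt0_muley//.
  by rewrite mule_gt0// lte_fin.
rewrite -(fineK cf) in key *; rewrite -(fineK Gf) -!EFinM in key.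
congr EFin; move: key => [].
rewrite /kappa Gamma_half.
set c := fine (cone_volume _ _ _); set g := fine (gamma_half _) in g0 *.
set I := pdf_cdf_integral _ _.
have -> : (pi *+ 2 : R) = 2 * pi by rewrite mulr_natl.
rewrite addnS -addSn exprD -!powR_half// powRM ?(ltW pi0)// => key.
have : 2 `^ (m.+1%:R / 2) * g * c =
  2 `^ (m.+1%:R / 2) * g * (pi `^ (m.+1%:R / 2) / g * (2 * pi) `^ (i%:R / 2) * I).
  rewrite key; field; exact: lt0r_neq0.
by apply: mulfI; rewrite mulf_neq0// lt0r_neq0.
Qed.

End gamma.

(** * Projection onto the simplex and the Steiner formula *)

Section mask_predicate.
Context {T : eqType}.

Lemma mask_map_filter (p : pred T) (s : seq T) : mask (map p s) s = seq.filter p s.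
Proof. by rewrite filter_mask. Qed.

Lemma mask_all_eq (p : pred T) (b : seq bool) (s : seq T) : size b = size s ->
  all p (mask b s) -> all (predC p) (mask (map negb b) s) -> b = map p s.
Proof.
elim: b s => [|c b IH] [|x s]//= [] /IH {}IH.
by case: c => /= [/andP[-> ps] ns|ps /andP[/negbTE -> ns]]; rewrite IH.
Qed.

End mask_predicate.

Lemma mask_of_inj n : injective (@mask_of n).
Proof.
move=> A B AB; apply/setP => i.
by have := congr1 (fun t => tnth t i) AB; rewrite !tnth_mktuple.
Qed.

Definition index_set (T : eqType) n (p : pred T) (x : n.-tuple T) : {set 'I_n} :=
  [set i | p (tnth x i)]%SET.

Lemma mask_of_index_set (T : eqType) n (p : pred T) (x : n.-tuple T) :
  mask_of (index_set p x) = map p x :> seq bool.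
Proof.
rewrite /= -[in RHS](map_tnth_enum x) -map_comp.
by apply: eq_map => i; rewrite inE.
Qed.

Lemma mask_index_set (T : eqType) n (p : pred T) (x : n.-tuple T) :
  mask (mask_of (index_set p x)) x = seq.filter p x.
Proof. by rewrite mask_of_index_set mask_map_filter. Qed.

Lemma maskN_index_set (T : eqType) n (p : pred T) (x : n.-tuple T) :
  mask (map negb (mask_of (index_set p x))) x = seq.filter (predC p) x.
Proof. by rewrite mask_of_index_set -map_comp mask_map_filter. Qed.

(** Gives uniqueness of the contributing index set: [A] is determined by a predicate true on the
    selected coordinates and false on the others. *)
Lemma index_set_eq (T : eqType) n (p : pred T) (A : {set 'I_n}) (x : n.-tuple T) :
  all p (mask (mask_of A) x) ->
  all (predC p) (mask (map negb (mask_of A)) x) -> A = index_set p x.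
Proof.
move=> pA nA; apply: mask_of_inj; apply/val_inj => /=.
rewrite (mask_all_eq _ pA nA) ?size_tuple//.
by rewrite -[RHS]/(val (mask_of _)) [RHS]mask_of_index_set.
Qed.

(** * Existence and uniqueness of the projection threshold *)

Section excess.
Context {R : realType}.
Implicit Types (s : seq R) (l : R).

Definition excess s l : R := \sum_(y <- s) Num.max (y - l) 0.

Lemma excess_filter s l : excess s l = \sum_(y <- s | l < y) (y - l).
Proof.
rewrite /excess [RHS]big_mkcond; apply: eq_bigr => y _.
by have [ly|yl] := ltP l y; [rewrite max_l// subr_ge0 ltW|rewrite max_r// subr_le0].
Qed.

(** The excess vanishes beyond the largest entry, so strict decrease holds only where it is
    positive: either the head is above [l] and its term grows strictly, or its term is 0 at [l] and
    the positivity comes from the tail. *)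
Lemma excess_decr s l l' : l' < l -> 0 < excess s l -> excess s l < excess s l'.
Proof.
move=> ll'; elim: s => [|y s IH]; first by rewrite /excess big_nil ltxx.
rewrite /excess !big_cons -!/(excess _ _) => pos.
have le_ex : excess s l <= excess s l'.
  apply: ler_sum => z _.
  by rewrite ge_max !le_max lexx orbT lerD2l lerN2 ltW.
have [ly|yl] := ltP l y.
  by rewrite ltr_leD// !max_l ?subr_ge0 ?ltD2l ?ltrD2l ?ltrN2// ltW// (lt_trans ll').
move: pos; rewrite max_r ?subr_le0// add0r => /IH h.
by rewrite ltr_wpDl// le_max lexx orbT.
Qed.

Lemma excess_uniq s l l' : excess s l = 1 -> excess s l' = 1 -> l = l'.
Proof.
move=> e e'; have [||//] := ltgtP l l'.
  by move=> /excess_decr => /(_ s); rewrite e e' ltr01 ltxx => /(_ isT).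
by move=> /excess_decr => /(_ s); rewrite e e' ltr01 ltxx => /(_ isT).
Qed.

(** Intermediate values: at [y0 - 1] the term of [y0] alone is 1, and at the largest entry all terms
    vanish. *)
Lemma excess_exists s : s != [::] -> exists l, excess s l = 1.
Proof.
case: s => [//|y0 s] _; set t := y0 :: s.
have ce : continuous (excess t).
  rewrite /excess; elim: t => [|y t IH] x.
    under eq_fun do rewrite big_nil; exact: cvg_cst.
  under eq_fun do rewrite big_cons.
  apply: cvgD; last exact: IH.
  apply: (@continuous_max _ _ (fun x => y - x) (fun=> 0)); last exact: cvg_cst.
  by apply: cvgB; [exact: cvg_cst|exact: cvg_id].
pose M := \big[Num.max/y0]_(y <- t) y.
have tM y : y \in t -> y <= M by move=> yt; rewrite /M le_bigmax_seq.
have M0 : excess t M = 0.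
  by rewrite /excess big1_seq// => y /= yt; rewrite max_r// subr_le0 tM.
have m1 : 1 <= excess t (y0 - 1).
  rewrite /excess big_cons -[leLHS]addr0 lerD//.
    by rewrite le_max opprB addrCA subrr addr0 lexx.
  by apply: sumr_ge0 => z _; rewrite le_max lexx orbT.
have le1 : y0 - 1 <= M by rewrite (@le_trans _ _ y0) ?lerBlDr ?lerDl// tM// mem_head.
have [||c _ ec] := @IVT R (excess t) (y0 - 1) M 1 le1.
- exact: continuous_subspaceT.
- by rewrite M0 ge_min le_max ler01 m1 orbT.
by exists c.
Qed.

End excess.

Section std_simplex.
Context {R : realType}.

Lemma conv_rowE n (x y : convex_lmodType 'rV[R]_n) (l : {i01 R}) (i : 'I_n) :
  (conv l x y : 'rV[R]_n) 0 i =
  l%:num * (x : 'rV[R]_n) 0 i + (1 - l%:num) * (y : 'rV[R]_n) 0 i.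
Proof. by rewrite !mxE. Qed.

(** For the inclusion from right to left, a convex set is closed under finite convex combinations,
    by induction on the list of indices: the first weight is split off and the others are divided by
    its complement to 1. *)
Lemma std_simplexE n : std_simplex R n =
  [set p : 'rV[R]_n | (forall i, 0 <= p 0 i) /\ \sum_(i < n) p 0 i = 1].
Proof.
apply/seteqP; split.
  apply: smallest_sub.
    move=> /= x y l; rewrite !inE /= => -[x0 x1] [y0 y1]; split=> [i|].
      by rewrite conv_rowE addr_ge0// mulr_ge0// subr_ge0 le1.
    under eq_bigr do rewrite conv_rowE.
    by rewrite big_split/= -!mulr_sumr x1 y1 !mulr1 addrC subrK.
  move=> _ [i _ <-]; split=> [j|]; first by rewrite mxE/=.
  rewrite (bigD1 i)//= mxE !eqxx big1 ?addr0// => j /negbTE ji.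
  by rewrite mxE eqxx eq_sym eq_sym ji.
move=> p [p0 p1] C [cC dC].
have comb (s : seq 'I_n) (w : 'I_n -> R) : (forall i, 0 <= w i) ->
    \sum_(i <- s) w i = 1 -> C (\sum_(i <- s) w i *: delta_mx 0 i).
  elim: s w => [|i s IH] w w0; first by rewrite big_nil => /esym/eqP; rewrite oner_eq0.
  rewrite !big_cons => w1.
  have s0 : 0 <= \sum_(j <- s) w j by exact: sumr_ge0.
  have dCi : C (delta_mx 0 i) by apply: dC; exists i.
  (* When the first weight is 1 the rescaling would divide by 0, but then all other weights
     vanish. *)
  have [wi1|wi1] := eqVneq (w i) 1.
    have : \sum_(j <- s) w j = 0 by move: w1; rewrite wi1; lra.
    move/eqP; rewrite psumr_eq0// => /allP h.
    rewrite wi1 scale1r big_seq big1 ?addr0// => j js.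
    by move/h: js => /=/eqP ->; rewrite scale0r.
  have c0 : 0 < 1 - w i by rewrite lt_neqAle eq_sym subr_eq0 eq_sym wi1/=; lra.
  have wi01 : (0 <= w i <= 1)%R by rewrite w0/=; lra.
  have := cC (delta_mx 0 i) (\sum_(j <- s) (w j / (1 - w i)) *: delta_mx 0 j)
    (Itv01 (w0 i) (proj2 (andP wi01))).
  rewrite !inE => /(_ dCi).
  have Cs : C (\sum_(j <- s) (w j / (1 - w i)) *: delta_mx 0 j).
    apply: IH => [j|]; first by rewrite divr_ge0// ltW.
    rewrite -mulr_suml; apply: (canLR (mulfK (lt0r_neq0 c0))); rewrite mul1r.
    by rewrite -w1 addrAC subrr add0r.
  move=> /(_ Cs); congr (C _).
  rewrite /conv/=; congr (_ + _).
  rewrite scaler_sumr; apply: eq_bigr => j _; rewrite scalerA.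
  by rewrite -[unstable.onem _]/(1 - w i) mulrC divfK// lt0r_neq0.
have -> : p = \sum_(i <- index_enum 'I_n) p 0 i *: delta_mx 0 i.
  by rewrite [LHS]row_sum_delta.
exact: comb.
Qed.

(** The Minkowski sum in terms of squared Euclidean distances. For r > 0 the ball vector is (x - p)
    / r; for r = 0 the distance condition forces x = p. *)
Lemma ball_simplexP n (r : R) (x : 'rV[R]_n) : 0 <= r ->
  [set p + r *: b | p in std_simplex R n & b in unit_ball R n] x <->
  exists2 p, std_simplex R n p & \sum_(i < n) (x 0 i - p 0 i) ^+ 2 <= r ^+ 2.
Proof.
move=> r0; split.
  move=> [p Sp [b Bb <-]]; exists p => //.
  under eq_bigr do rewrite !mxE addrAC subrr add0r exprMn.
  rewrite -mulr_sumr -[leRHS]mulr1 ler_wpM2l ?sqr_ge0//.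
  have s0 : 0 <= \sum_(i < n) b 0 i ^+ 2 by apply: sumr_ge0 => i _; exact: sqr_ge0.
  by rewrite -(sqr_sqrtr s0) expr_le1// sqrtr_ge0.
move=> [p Sp]; have [->|rn0] := eqVneq r 0.
  rewrite expr0n/= => h; exists p => //; exists 0.
    rewrite /unit_ball/= /enorm big1 ?sqrtr0// => i _.
    by rewrite mxE expr0n.
  rewrite scale0r addr0; apply/rowP => i.
  have /eqP : \sum_(i < n) (x 0 i - p 0 i) ^+ 2 = 0.
    by apply/le_anti; rewrite h sumr_ge0// => j _; exact: sqr_ge0.
  rewrite psumr_eq0 => [/allP/(_ i (mem_index_enum _))|j _]; last exact: sqr_ge0.
  by rewrite /= sqrf_eq0 subr_eq0 => /eqP.
have rp : 0 < r by rewrite lt_neqAle eq_sym rn0.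
move=> h; exists p => //; exists (r^-1 *: (x - p)); last first.
  by rewrite scalerA mulfV// scale1r addrC subrK.
rewrite /unit_ball/= /enorm -sqrtr1 ler_sqrt//.
under eq_bigr do rewrite !mxE exprMn.
by rewrite -mulr_sumr exprVn ler_pdivrMl ?mulr1// exprn_gt0.
Qed.

(* The nearest point of the simplex is obtained from [x] by lowering all its
   coordinates by [l] and truncating at [0], with [l] such that they sum to 1. *)
Lemma simplex_distP n (r : R) (x : n.-tuple R) (l : R) :
  excess x l = 1 ->
  (exists2 p, std_simplex R n p &
    \sum_(i < n) ((\row_i tnth x i) 0 i - p 0 i) ^+ 2 <= r ^+ 2) <->
  \sum_(y <- x) Num.min y l ^+ 2 <= r ^+ 2.
Proof.
move=> xl; rewrite std_simplexE.
pose q := \row_(i < n) Num.max (tnth x i - l) 0.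
have xq i : tnth x i - q 0 i = Num.min (tnth x i) l.
  rewrite mxE; have [h|/ltW h] := leP (tnth x i) l.
    by rewrite max_r ?subr_le0// subr0.
  by rewrite max_l ?subr_ge0//; ring.
have q1 : \sum_(i < n) q 0 i = 1.
  by rewrite -xl /excess big_tuple; apply: eq_bigr => i _; rewrite mxE.
split.
  move=> [p [p0 p1]]; apply: le_trans; rewrite big_tuple.
  rewrite -subr_ge0 -sumrB.
  (* [l] is the Lagrange multiplier of the constraint on the sum: the terms 2 l (q_i - p_i) add up
     to 0 because both points have sum 1, and with them the comparison holds coordinate by
     coordinate. *)
  apply: (@le_trans _ _ (\sum_(i < n) (2 * l * (q 0 i - p 0 i)))).
    by rewrite -mulr_sumr sumrB q1 p1 subrr mulr0.
  apply: ler_sum => i _; rewrite !mxE -xq.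
  have := p0 i; rewrite mxE.
  set y := tnth x i; set z := p 0 i => z0.
  have [h|/ltW h] := leP y l.
    by rewrite max_r ?subr_le0//; nra.
  by rewrite max_l ?subr_ge0//; have := sqr_ge0 (y - z - l); nra.
move=> h; exists q.
  by split => // i; rewrite mxE le_max lexx orbT.
move: h; rewrite big_tuple; apply: le_trans; rewrite le_eqVlt; apply/orP; left.
by apply/eqP/eq_bigr => i _; rewrite -xq !mxE.
Qed.

End std_simplex.

(** * Volume of the neighbourhoods of the simplex and identification of its intrinsic volumes *)

Section steiner.
Context {R : realType}.
Local Notation mu := (@lebesgue_measure R).
Local Notation T := (measurableTypeR R).

Lemma level_filter (s : seq R) (l : R) : excess s l = 1 ->
  (0 < size (seq.filter (fun y => l < y)%R s))%N /\
  level (seq.filter (fun y => l < y) s) = l.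
Proof.
rewrite excess_filter -big_filter => e.
have s0 : (0 < size (seq.filter (fun y => l < y)%R s))%N.
  rewrite lt0n; apply/eqP => /size0nil h; move: e.
  by rewrite h big_nil => /esym/eqP; rewrite oner_eq0.
split => //; move: e s0; set u := seq.filter _ _.
rewrite sumrB big_const_seq count_predT iter_addr_0 /level => e s0.
apply: (canLR (mulfK _)); first by rewrite pnatr_eq0 -lt0n.
by rewrite mulr_natr; lra.
Qed.

(** Converse of [level_filter]: if [u] lies above its own level and [v] does not, that level is the
    threshold of the whole tuple. *)
Lemma excess_level (s u v : seq R) : (0 < size u)%N ->
  (forall F : R -> R, \sum_(y <- s) F y = \sum_(y <- u) F y + \sum_(y <- v) F y) ->
  all (fun y => level u < y) u -> all (fun y => y <= level u) v ->
  excess s (level u) = 1.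
Proof.
move=> s0 split_sum /allP ul /allP vl; rewrite /excess split_sum.
rewrite [X in _ + X]big1_seq => [|y /andP[_ /vl]]; last first.
  by move=> h; rewrite max_r// subr_le0.
rewrite (eq_big_seq (fun y => y - level u)) => [|y /ul h]; last first.
  by rewrite max_l// subr_ge0 ltW.
rewrite sumrB big_const_seq count_predT iter_addr_0 /level -[_ *+ _]mulr_natr.
rewrite divfK; first by rewrite addr0; ring.
by rewrite pnatr_eq0 -lt0n.
Qed.

Lemma big_mask_split (b : seq bool) (s : seq R) (F : R -> R) : size b = size s ->
  \sum_(y <- s) F y =
  \sum_(y <- mask b s) F y + \sum_(y <- mask (map negb b) s) F y.
Proof.
elim: b s => [|c b IH] [|y s]//=; first by rewrite !big_nil addr0.
by move=> [/IH h]; case: c; rewrite !big_cons h; ring.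
Qed.

(** Only the set of indices above the threshold contributes; there the squared distance splits into
    |u| l^2 and the squares of the remaining coordinates. *)
Lemma sum_steiner_piece n (x : n.-tuple R) (r : R) : (0 < n)%N ->
  exists2 l, excess x l = 1 &
  (\sum_(A : {set 'I_n}) steiner_piece (r ^+ 2)
     (mask (mask_of A) x) (mask (map negb (mask_of A)) x) =
   iverson (\sum_(y <- x) Num.min y l ^+ 2 <= r ^+ 2)%R)%E.
Proof.
move=> n0; have [|l xl] := @excess_exists R x; first by rewrite -size_eq0 size_tuple -lt0n.
exists l => //.
have predE : predC (fun y : R => l < y) =1 (fun y => y <= l).
  by move=> y /=; rewrite leNgt.
rewrite (bigD1 (index_set (fun y => l < y) x))//= big1 => [|A nA].
  rewrite adde0 mask_index_set maskN_index_set (eq_filter predE).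
  have [s0 lu] := level_filter xl.
  rewrite /steiner_piece s0 lu filter_all filter_all/=; congr iverson.
  rewrite [in RHS](big_mask_split (b := map (fun y => l < y) x)) ?size_map//.
  rewrite -map_comp !mask_map_filter (eq_filter predE).
  congr (_ + _ <= _).
    rewrite (eq_big_seq (fun=> l ^+ 2)) => [|y]; last first.
      by rewrite mem_filter => /andP[/ltW h _]; rewrite min_r.
    by rewrite big_const_seq count_predT iter_addr_0 mulr_natl.
  apply: eq_big_seq => y; rewrite mem_filter => /andP[h _].
  by rewrite min_l.
(* A contributing [A] has a level of excess 1, which is [l] by uniqueness, so [A] is the set already
   singled out. *)
rewrite /steiner_piece; set u := mask _ _; set v := mask _ _.
case: (boolP [&& _, _, _ & _]) => // /and4P[u0 ul vl _].
have e : excess x (level u) = 1.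
  apply: (excess_level u0 _ ul vl) => F.
  by apply: big_mask_split; rewrite (size_tuple (mask_of A)) size_tuple.
move: nA; rewrite (@index_set_eq _ _ (fun y => l < y) A x) ?eqxx//.
  by rewrite (excess_uniq xl e).
by rewrite (excess_uniq xl e) (eq_all (a2 := fun y => y <= level u))// => y /=; rewrite leNgt.
Qed.

Lemma volume_simplex_ball n (r : R) : (0 < n)%N -> 0 <= r ->
  volume [set x + r *: b | x in std_simplex R n & b in unit_ball R n] =
  (\sum_(j < n.+1) ('C(n, j)%:R)%:E *
     double_integral mu (steiner_piece (r ^+ 2)) j (n - j))%E.
Proof.
move=> n0 r0.
have mS := @seq_measurable_steiner_piece R (r ^+ 2).
have S0 u v : (0 <= steiner_piece (r ^+ 2) u v :> \bar R)%E by exact: iverson_ge0.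
rewrite -integral_sum_mask// /volume lebesgue_tupleE.
set D := [set t | _].
pose F (x : n.-tuple T) := (\sum_(A : {set 'I_n}) steiner_piece (r ^+ 2)
     (mask (mask_of A) x) (mask (map negb (mask_of A)) x))%E.
have mF : measurable_fun setT F.
  by apply: emeasurable_sum => A; exact: seq_measurable_mask.
have FE x : F x = (\1_D x)%:E.
  have [l xl] := @sum_steiner_piece n x r n0; rewrite -/(F x) => ->.
  rewrite indicE; congr (nat_of_bool _)%:R%:E.
  apply/idP/idP.
    by move=> h; rewrite inE; apply/(ball_simplexP _ r0)/(simplex_distP _ xl).
  by rewrite inE => /(ball_simplexP _ r0)/(simplex_distP _ xl).
(* The neighbourhood is measurable as a level set of the sum of pieces, which is its indicator. *)
have mD : measurable D.
  rewrite (_ : D = F @^-1` [set 1%E]); first by rewrite -[X in measurable X]setTI; exact: mF.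
  apply/seteqP; split => x /=; rewrite FE indicE.
    by move=> Dx; rewrite mem_set.
  case: (boolP (x \in D)); first by rewrite inE.
  by move=> _ /eqP; rewrite eqe eq_sym oner_eq0.
transitivity (tuple_power mu n (D `&` setT)); first by rewrite setIT.
by rewrite -integral_indic//; apply: eq_integral => x _; rewrite -FE.
Qed.

Lemma steiner_std_simplex n (V : nat -> R) : (0 < n)%N ->
  (forall k, (k < n)%N -> V k = k.+1%:R * 'C(n, k.+1)%:R / k`!%:R *
      ((2 * pi) `^ (k%:R / 2) * pdf_cdf_integral k (n - k.+1))) ->
  V n = 0 -> steiner_formula (std_simplex R n) V.
Proof.
move=> n0 VE Vn r r0; rewrite volume_simplex_ball//.
(* The empty index set contributes nothing; dropping it shifts the index, so that j = k + 1 large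
   coordinates match V_k. On the other side the term of V_n drops out. *)
rewrite big_ord_recl double_integral_steiner_piece0 mule0 add0e.
rewrite [in RHS]big_ord_recr [in RHS]/= Vn mulr0 mul0r addr0 -sumEFin.
apply: eq_bigr => k _; rewrite lift0 double_integral_steiner_piece.
have kn := ltn_ord k; rewrite VE//.
have nk : (n - k = (n - k.+1).+1)%N by rewrite subnSK.
have -> : cone_volume k (n - k.+1) (r ^+ 2) =
    (r ^+ (n - k) * (kappa R (n - k) * (2 * pi) `^ (k%:R / 2) * pdf_cdf_integral k (n - k.+1)))%:E.
  move: r0; rewrite le_eqVlt => /predU1P[<-|r0].
    by rewrite expr0n/= cone_volume0 nk expr0n/= mul0r.
  by rewrite cone_volume_scale// cone_volume1E -nk EFinM.
rewrite -!EFinM; congr EFin.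
by ring.
Qed.

(** Both solutions give polynomials in r of degree at most n that agree at the n + 1 points 0, ...,
    n, hence have equal coefficients, and kappa_(n-k) is cancelled. *)
Lemma intrinsic_volumeE n (S : set 'rV[R]_n) (V : nat -> R) k : (k < n)%N ->
  steiner_formula S V -> intrinsic_volume S k = V k.
Proof.
move=> kn SV; rewrite /intrinsic_volume.
have : [set V | steiner_formula S V] (xget (fun=> 0) [set V | steiner_formula S V]).
  exact: (xgetI _ SV).
set W := xget _ _ => /= SW.
pose p (U : nat -> R) : {poly R} := \poly_(i < n.+1) (kappa R i * U (n - i)%N).
have pE U r : (p U).[r] = \sum_(j < n.+1) kappa R (n - j) * U j * r ^+ (n - j).
  rewrite horner_poly (reindex_inj rev_ord_inj)/=; apply: eq_bigr => j _.
  by rewrite subSS subKn// -ltnS.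
have pp : p W = p V.
  apply/eqP; rewrite -subr_eq0; apply/eqP/(@roots_geq_poly_eq0 _ _ [seq i%:R | i <- iota 0 n.+1]).
  - apply/allP => _ /mapP[i _ ->]; rewrite rootE hornerD hornerN !pE.
    have i0 : (0 : R) <= i%:R by [].
    by have := SW _ i0; rewrite (SV _ i0) => -[->]; rewrite subrr.
  - rewrite map_inj_uniq ?iota_uniq// => a b /eqP; rewrite eqr_nat => /eqP//.
  - rewrite size_map size_iota (leq_trans (size_polyD _ _))// geq_max size_polyN.
    by rewrite !size_poly.
have := congr1 (fun q : {poly R} => q`_(n - k)) pp.
rewrite !coef_poly ltnS leq_subr subKn ?(ltnW kn)//.
apply: mulfI; rewrite -(subnSK kn); exact/lt0r_neq0/kappa_gt0.
Qed.

End steiner.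

(** * The joint law of independent normal variables *)

Lemma iverson_or (R : realType) (a b : bool) :
  (iverson (a || b) <= iverson a + iverson b :> \bar R)%E.
Proof.
by case: a; case: b; rewrite /iverson -EFinD lee_fin/= ?addr0 ?add0r ?lerDl.
Qed.

Section tuple_power_laws.
Context d (T : measurableType d) {R : realType}.
Variable mu : {sigma_finite_measure set T -> \bar R}.

Definition box n (B : 'I_n -> set T) : set (n.-tuple T) :=
  [set t | forall i, B i (tnth t i)].

Lemma measurable_box n (B : 'I_n -> set T) :
  (forall i, measurable (B i)) -> measurable (box B).
Proof.
move=> mB.
rewrite (_ : box B = \big[setI/setT]_(i < n) ((@tnth n T)^~ i @^-1` B i)).
  apply: bigsetI_measurable => i _.
  by rewrite -[X in measurable X]setTI; exact: measurable_tnth.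
rewrite -bigcap_seq; apply/seteqP; split => t h i //=.
exact/h/mem_index_enum.
Qed.

(** Boxes are stable under intersection, unlike the preimages under single coordinates that generate
    the sigma-algebra of tuples; uniqueness of measures needs such a generating family. *)
Lemma measurable_tupleE n :
  @measurable _ (n.-tuple T) = <<s [set A | exists B : 'I_n -> set T,
    (forall i, measurable (B i)) /\ A = box B] >>.
Proof.
apply/seteqP; split.
  apply: smallest_sub; first exact: smallest_sigma_algebra.
  move=> A; rewrite -bigcup_seq => -[i _ [Y mY <-]].
  apply: sub_sigma_algebra; exists (fun j => if j == i then Y else setT); split.
    by move=> j; case: ifP.
  apply/seteqP; split => t /=.
    by move=> [_ h] j; case: eqP => // ->.
  by move=> /(_ i); rewrite eqxx.
apply: smallest_sub; first exact: sigma_algebra_measurable.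
by move=> A [B [mB ->]]; exact: measurable_box.
Qed.

Lemma tuple_power_box n (B : 'I_n -> set T) : (forall i, measurable (B i)) ->
  (tuple_power mu n (box B) = \prod_(i < n) mu (B i))%E.
Proof.
elim: n B => [|n IH] B mB.
  rewrite big_ord0 /= diracE mem_set//.
  by case.
rewrite big_ord_recl -IH//.
rewrite -product_measure1E//; last exact: measurable_box.
rewrite /= /tuple_step /pushforward; congr (product_measure1 _ _ _).
apply/seteqP; split => -[x t] /=.
  move=> h; split; first exact: (h ord0).
  by move=> i; have := h (lift ord0 i); rewrite tnthS.
move=> [Bx Bt] i; case: (unliftP ord0 i) => [j|] ->; last by [].
by rewrite tnthS; exact: Bt.
Qed.

End tuple_power_laws.

(** * Ties have measure zero for powers of a measure without atoms *)

Section no_ties.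
Context {R : realType}.
Local Notation T := (measurableTypeR R).
Variable mu : {sigma_finite_measure set T -> \bar R}.
Hypothesis mu1 : forall x, mu [set x] = 0%E.

Lemma measurable_mem_tuple d (Z : measurableType d) n (f : Z -> T) (g : Z -> n.-tuple T) :
  measurable_fun setT f -> measurable_fun setT g ->
  measurable_fun setT (fun z => f z \in (g z : seq R)).
Proof.
move=> mf mg.
(* Membership is rewritten with strict comparisons, whose measurability is at hand. *)
rewrite (_ : (fun _ => _) = fun z => ~~ all (fun y => (y < f z) || (f z < y)) (g z)).
  apply: measurable_neg.
  apply: (measurable_all_tuple (h := fun z y => (y < f z) || (f z < y))) => //.
  have mf1 : measurable_fun setT (fun p : Z * T => f p.1).
    exact: (measurableT_comp mf measurable_fst).
  by apply: measurable_or; exact: measurable_fun_ltr.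
apply/funext => z; rewrite -has_predC; apply/idP/hasP.
  by move=> h; exists (f z) => //=; rewrite ltxx.
move=> [y yg /=]; rewrite -real_neqr_lt ?num_real// negbK => /eqP <-.
exact: yg.
Qed.

Lemma measurable_uniq_tuple n :
  measurable_fun setT (fun t : n.-tuple T => uniq (t : seq R)).
Proof.
elim: n => [|n IH].
  rewrite (_ : (fun _ => _) = cst true); first exact: measurable_cst.
  by apply/funext => t; rewrite (tuple0 t).
rewrite (_ : (fun _ => _) = fun t : n.+1.-tuple T =>
   ~~ (thead t \in ([tuple of behead t] : seq R)) && uniq ([tuple of behead t] : seq R)).
  apply: measurable_and.
    apply/measurable_neg/measurable_mem_tuple; first exact: measurable_tnth.
    exact: measurable_behead.
  exact: (measurableT_comp IH (@measurable_behead _ T n)).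
by apply/funext => t; rewrite {1}(tuple_eta t).
Qed.

Lemma measure_finite_set0 (s : seq R) : (\int[mu]_x iverson (x \in s) = 0)%E.
Proof.
have m1 (y : T) : measurable_fun setT (fun x : T => iverson (x \in [:: (y : R)]) : \bar R).
  apply: measurable_iverson.
  exact: (measurable_mem_tuple (f := id) (g := cst [tuple y])).
have ms (s' : seq R) : measurable_fun setT (fun x : T => iverson (x \in s') : \bar R).
  apply: measurable_iverson.
  exact: (measurable_mem_tuple (f := id) (g := cst (in_tuple s'))).
elim: s => [|y s IH]; first exact: integral0_eq.
apply/eqP; rewrite eq_le; apply/andP; split; last exact: integral_ge0.
apply: (@le_trans _ _ (\int[mu]_x (iverson (x \in [:: y]) + iverson (x \in s)))%E).
  apply: ge0_le_integral => //.
  - by apply: emeasurable_funD; [exact: m1|exact: ms].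
  by move=> x _; rewrite !inE; exact: iverson_or.
rewrite ge0_integralD//.
rewrite IH adde0 integral_iverson; last first.
  exact: (measurable_mem_tuple (f := id) (g := cst [tuple y])).
rewrite le_eqVlt; apply/orP; left; apply/eqP; rewrite -(mu1 y); congr (mu _).
by apply/seteqP; split => x /=; rewrite inE => /eqP.
Qed.

(** A tie involves either the first coordinate, which then takes one of finitely many values for a
    fixed tail, or only the tail; Tonelli and induction deal with the two cases. *)
Lemma integral_not_uniq n :
  (\int[tuple_power mu n]_t iverson (~~ uniq (t : seq R)) = 0)%E.
Proof.
elim: n => [|n IH]; first by rewrite integral_tuple_power0.
have mu_ m : measurable_fun setT (fun t : m.-tuple T => iverson (~~ uniq (t : seq R)) : \bar R).
  by apply: measurable_iverson; apply: measurable_neg; exact: measurable_uniq_tuple.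
rewrite integral_tuple_powerS//.
have mF : measurable_fun setT (fun p : T * n.-tuple T => iverson (~~ uniq (tcons p : seq R)) : \bar R).
  exact: (measurableT_comp (mu_ n.+1) (@measurable_tcons _ _ _)).
rewrite (fubini_tonelli (m1 := mu) (m2 := tuple_power mu n)
  (fun p => iverson (~~ uniq (tcons p : seq R))))//.
have mm (t : n.-tuple T) : measurable_fun setT (fun x : T => iverson (x \in (t : seq R)) : \bar R).
  apply: measurable_iverson.
  exact: (measurable_mem_tuple (f := id) (g := cst t)).
have mIH : measurable_fun setT (fun p : T * n.-tuple T => iverson (~~ uniq (p.2 : seq R)) : \bar R).
  exact: (measurableT_comp (mu_ n) measurable_snd).
apply/eqP; rewrite eq_le; apply/andP; split; last first.
  by apply: integral_ge0 => t _; exact: integral_ge0.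
apply: (@le_trans _ _ (\int[tuple_power mu n]_t \int[mu]_x iverson (~~ uniq (t : seq R)))%E).
  apply: ge0_le_integral => //.
  - by move=> t _; exact: integral_ge0.
  - exact: (measurable_fun_fubini_tonelli_G (m1 := mu) (fun p : T * n.-tuple T => iverson (~~ uniq (tcons p : seq R)))).
  - exact: (measurable_fun_fubini_tonelli_G (m1 := mu) (fun p : T * n.-tuple T => iverson (~~ uniq (p.2 : seq R)))).
  move=> t _.
  apply: (@le_trans _ _ (\int[mu]_x (iverson (x \in (t : seq R)) + iverson (~~ uniq (t : seq R))))%E).
    apply: ge0_le_integral => //.
    - exact: (measurableT_comp mF (pair2_measurable t)).
    - by apply: emeasurable_funD; [exact: mm|exact: measurable_cst].
    by move=> x _; rewrite /= negb_and negbK; exact: iverson_or.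
  by rewrite ge0_integralD// measure_finite_set0 add0e.
rewrite -(fubini_tonelli (m1 := mu) (m2 := tuple_power mu n)
  (fun p => iverson (~~ uniq (p.2 : seq R))))//=.
by under eq_integral do rewrite IH; rewrite integral0.
Qed.

Lemma integral_uniq_eq n (f g : n.-tuple T -> \bar R) :
  measurable_fun setT f -> measurable_fun setT g ->
  (forall t : n.-tuple T, uniq (t : seq R) -> f t = g t) ->
  (\int[tuple_power mu n]_t f t = \int[tuple_power mu n]_t g t)%E.
Proof.
move=> mf mg fg; apply: ae_eq_integral => //.
have mN : measurable [set t : n.-tuple T | ~~ uniq (t : seq R)].
  apply: measurable_set_of_bool; apply: measurable_neg.
  exact: measurable_uniq_tuple.
exists [set t : n.-tuple T | ~~ uniq (t : seq R)]; split => //.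
  rewrite -integral_iverson; first exact: integral_not_uniq.
  by apply: measurable_neg; exact: measurable_uniq_tuple.
by move=> t /= ntE; apply/negP => ut; apply: ntE => _; exact: fg.
Qed.

End no_ties.

(** * The law of the vector of the variables *)

Section joint_law.
Context {R : realType} d (Omega : measurableType d) (P : probability Omega R).
Local Notation T := (measurableTypeR R).
Variables (n : nat) (xi : 'I_n -> {RV P >-> R}).
Local Notation gauss := (tuple_power (normal_prob (0 : R) 1) n).

Definition joint (w : Omega) : n.-tuple T := [tuple (xi i w : T) | i < n].

Lemma measurable_joint : measurable_fun setT joint.
Proof.
apply/measurable_fun_tnthP => i.
rewrite (_ : _ \o _ = xi i); first exact: (measurable_funP (xi i)).
by apply/funext => w /=; rewrite tnth_mktuple.
Qed.

Hypothesis indep : mutually_independent xi.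
Hypothesis normal : forall i, standard_normal (xi i).

Lemma joint_law A : measurable A -> gauss A = P (joint @^-1` A).
Proof.
move=> mA.
pose m2 := measure_function_pushforward__canonical__measure_function_Measure P measurable_joint.
rewrite -[RHS]/(m2 A).
have mT : box (fun=> setT : set T) = [set: n.-tuple T].
  by apply/seteqP; split.
apply: (measure_unique [set A | exists B : 'I_n -> set T,
    (forall i, measurable (B i)) /\ A = box B] (fun=> setT)) => //.
- exact: (@measurable_tupleE _ T n).
- move=> _ _ [B [mB ->]] [C [mC ->]]; exists (fun i => B i `&` C i); split.
    by move=> i; exact: measurableI.
  by apply/seteqP; split => t; [move=> [h1 h2] i; split|move=> h; split => i; have [] := h i].
- by move=> _; exists (fun=> setT).
- by rewrite bigcup_const.
- move=> _ [B [mB ->]].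
  transitivity (\prod_(i < n) normal_prob 0 1 (B i))%E.
    exact: tuple_power_box.
  (* Independence over the full index set gives the probability of a box; the law of each variable
     enters factor by factor. *)
  have := indep (J := [set: 'I_n]%SET) (B := B) (fun i _ => mB i).
  rewrite (_ : \bigcap_(i in _) _ = joint @^-1` box B); last first.
    apply/seteqP; split => w /= h i.
      by rewrite tnth_mktuple; apply: h; rewrite /= inE.
    by move=> _; have := h i; rewrite tnth_mktuple.
  rewrite /m2/= /pushforward => ->.
  apply: eq_big => [i|i _]; first by rewrite inE.
  by rewrite -(normal i (mB i)).
- move=> _; apply: (@le_lt_trans _ _ (\prod_(i < n) normal_prob (0 : R) 1 setT)%E).
    rewrite le_eqVlt; apply/orP; left; apply/eqP; rewrite -[LHS]/(gauss _) -mT.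
    exact: (tuple_power_box _ (B := fun=> setT)).
  by rewrite big1 ?ltry// => i _; exact: probability_setT.
Qed.

Lemma expectation_joint (h : n.-tuple T -> R) : measurable_fun setT h ->
  ('E_P[h \o joint] = \int[gauss]_t (h t)%:E)%E.
Proof.
move=> mh; rewrite unlock.
have me : measurable_fun setT (EFin \o h) by exact/measurable_EFinP.
have tr (g : n.-tuple T -> \bar R) : measurable_fun setT g -> (forall t, 0 <= g t)%E ->
    (\int[P]_w g (joint w) = \int[gauss]_t g t)%E.
  move=> mg g0.
  rewrite [RHS](@eq_measure_integral _ _ _ _
    (measure_function_pushforward__canonical__measure_function_Measure P measurable_joint)).
    by rewrite (ge0_integral_pushforward measurable_joint)//= preimage_setT.
  by move=> A mA _; exact: joint_law.
rewrite integralE [RHS]integralE; congr (_ - _)%E.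
  transitivity (\int[P]_w (EFin \o h)^\+ (joint w))%E.
    by apply: eq_integral => w _; rewrite !funeposE.
  rewrite (tr ((EFin \o h)^\+)%E); last 2 first.
  - exact: measurable_funepos.
  - by move=> t; exact: funepos_ge0.
  by apply: eq_integral => t _; rewrite !funeposE.
transitivity (\int[P]_w (EFin \o h)^\- (joint w))%E.
  by apply: eq_integral => w _; rewrite !funenegE.
rewrite (tr ((EFin \o h)^\-)%E); last 2 first.
- exact: measurable_funeneg.
- by move=> t; exact: funeneg_ge0.
by apply: eq_integral => t _; rewrite !funenegE.
Qed.

End joint_law.

(** * Order statistics and the expectation *)

Section order_statistics.
Context {R : realType}.
Implicit Types (s : seq R) (c : R).

(** Turns a condition on an order statistic into a count, which does not depend on the order of the
    entries. *)
Lemma sorted_nth_count s c i : sorted <=%R s -> (i < size s)%N ->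
  (c <= nth 0 s i) = (size s - i <= count (fun y => c <= y)%R s)%N.
Proof.
move=> ss isz; have tr : transitive (<=%R : rel R) by exact: le_trans.
rewrite -{3}(cat_take_drop i s) count_cat.
have [ci|ci] := leP c (nth 0 s i).
  suff -> : count (fun y => c <= y) (drop i s) = (size s - i)%N by rewrite leq_addl.
  rewrite -size_drop; apply/eqP; rewrite -all_count; apply/(all_nthP 0) => j.
  rewrite size_drop nth_drop => jlt; apply: (le_trans ci).
  have ij : (i + j < size s)%N by rewrite -ltn_subRL.
  apply: (sorted_leq_nth tr _ 0 ss); [exact: lexx|..] => //=.
  exact: leq_addr.
apply/esym/negbTE; rewrite -ltnNge.
have -> : count (fun y => c <= y) (take i s) = 0%N.
  apply/eqP; rewrite -leqn0 leqNgt -has_count; apply/(has_nthP 0) => -[j].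
  rewrite size_take isz => ji; rewrite nth_take// leNgt => /negP; apply.
  apply: le_lt_trans ci; apply: (sorted_leq_nth tr _ 0 ss) => //; rewrite ?inE//; lia.
rewrite add0n (drop_nth 0 isz)/= leNgt ci add0n.
by rewrite (leq_ltn_trans (count_size _ _))// size_drop; lia.
Qed.

Lemma max_coord_mem n (x : 'I_n -> R) : (0 < n)%N -> max_coord x \in codom x.
Proof.
move=> n0; rewrite /max_coord.
have : head 0 (codom x) \in codom x.
  have : size (codom x) = n by rewrite size_codom card_ord.
  by case: (codom x) => [/= n0'|y s _]; [move: n0; rewrite -n0'|rewrite mem_head].
set h := head _ _ => hx; elim/big_ind: _ => //.
  by move=> a b ax bx; case: (leP a b).
by move=> i _; exact: codom_f.
Qed.

Lemma max_coord_ge n (x : 'I_n -> R) y : y \in codom x -> y <= max_coord x.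
Proof. by move=> /codomP[i ->]; rewrite /max_coord le_bigmax. Qed.

Lemma order_stat_max n (x : 'I_n -> R) : (0 < n)%N -> order_stat x n = max_coord x.
Proof.
move=> n0; have sz : size (sort <=%R (codom x)) = n.
  by rewrite size_sort size_codom card_ord.
have ss : sorted <=%R (sort <=%R (codom x)) by exact: (sort_sorted (@le_total _ R)).
have tr : transitive (<=%R : rel R) by exact: le_trans.
rewrite /order_stat; apply/le_anti/andP; split.
  by apply: max_coord_ge; rewrite -(mem_sort <=%R) mem_nth// sz; lia.
have := max_coord_mem x n0; rewrite -(mem_sort <=%R) => /(nthP 0)[j jn <-].
by rewrite sz in jn; apply: (sorted_leq_nth tr _ 0 ss); rewrite ?inE ?sz//; lia.
Qed.

(** The count includes the maximum itself, so k - 1 other coordinates are required near it. *)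
Lemma top_gapE n (x : 'I_n -> R) k eps : (1 <= k <= n)%N ->
  (order_stat x n - order_stat x (n - k + 1) <= eps) =
  (k <= count (fun y => max_coord x - eps <= y)%R (codom x))%N.
Proof.
move=> /andP[k1 kn]; have n0 : (0 < n)%N by lia.
have sz : size (sort <=%R (codom x)) = n.
  by rewrite size_sort size_codom card_ord.
rewrite order_stat_max// lerBlDr -lerBlDl /order_stat.
rewrite sorted_nth_count; last 2 first.
- exact: (sort_sorted (@le_total _ R)).
- by rewrite sz; lia.
rewrite sz (permP (permEl (perm_sort _ _))).
by congr (_ <= _)%N; lia.
Qed.

End order_statistics.

Lemma perm_mask_split (T : eqType) (b : seq bool) (s : seq T) : size b = size s ->
  perm_eq (mask b s ++ mask (map negb b) s) s.
Proof.
move=> bs; apply/permP => a; rewrite count_cat.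
elim: b s bs => [|c b IH] [|x s]//= [] /IH <-.
by case: c => /=; lia.
Qed.

(** * Splitting by the position of the maximum and by the coordinates close to it *)

Section window.
Context {R : realType}.
Local Notation T := (measurableTypeR R).

(** The candidate index set is a singleton, whose coordinate [y] should be the maximum; [k] counts
    the other coordinates within [eps] of it. *)
Definition one_hot (g : R -> R) (eps : R) (k : nat) (u v : seq R) : \bar R :=
  if u is [:: y] then
    ((g y)%:E * iverson (all (fun z => z <= y)%R v &&
                         (k <= count (fun z => y - eps <= z)%R v)%N))%E
  else 0%E.

Lemma one_hot_ge0 g eps k u v : (forall y, 0 <= g y) -> (0 <= one_hot g eps k u v)%E.
Proof. by move=> g0; case: u => [|y []]//=; rewrite mule_ge0// lee_fin. Qed.

Lemma measurable_count_tuple d (Z : measurableType d) n k (f : Z -> T) (g : Z -> n.-tuple T) :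
  measurable_fun setT f -> measurable_fun setT g ->
  measurable_fun setT (fun z => (k <= count (fun y => f z <= y)%R (g z))%N).
Proof.
move=> mf mg.
rewrite (_ : (fun _ => _) = fun z => k%:R <= \sum_(y <- g z) (f z <= y)%R%:R :> R).
  apply: measurable_fun_ler => //.
  apply: (measurable_sum_tuple (h := fun z y => (f z <= y)%R%:R)) => //.
  rewrite (_ : (fun _ => _) = fun p : Z * T => if f p.1 <= p.2 then 1 else 0 : R).
    apply: measurable_fun_ifT => //; apply: measurable_fun_ler => //.
    exact: (measurableT_comp mf measurable_fst).
  by apply/funext => p; case: ifP.
apply/funext => z; rewrite -natr_sum ler_nat -sum1_count big_mkcond/=.
by congr (_ <= _)%N; apply: eq_bigr => y _; case: ifP.
Qed.

Lemma measurable_all_le d (Z : measurableType d) n (f : Z -> T) (g : Z -> n.-tuple T) :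
  measurable_fun setT f -> measurable_fun setT g ->
  measurable_fun setT (fun z => all (fun y => y <= f z)%R (g z)).
Proof.
move=> mf mg; apply: (measurable_all_tuple (h := fun z y => y <= f z)) => //.
by apply: measurable_fun_ler => //; exact: (measurableT_comp mf measurable_fst).
Qed.

Lemma seq_measurable_one_hot g eps k : measurable_fun setT g ->
  seq_measurable (one_hot g eps k : seq T -> seq T -> \bar R).
Proof.
move=> mg [|[|i]] m.
- rewrite (_ : (fun _ => _) = cst 0%E); first exact: measurable_cst.
  by apply/funext => -[u v]; rewrite (tuple0 u).
- rewrite (_ : (fun _ => _) = fun p : 1.-tuple T * m.-tuple T =>
    ((g (thead p.1))%:E * iverson (all (fun z => z <= thead p.1)%R p.2 &&
       (k <= count (fun z => thead p.1 - eps <= z)%R p.2)%N))%E); last first.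
    by apply/funext => -[u v]; case/tupleP: u => y u; rewrite (tuple0 u).
  have mh : measurable_fun setT (fun p : 1.-tuple T * m.-tuple T => thead p.1).
    exact: (measurableT_comp (measurable_tnth ord0) measurable_fst).
  apply: emeasurable_funM.
    by apply/measurable_EFinP; exact: (measurableT_comp mg mh).
  apply: measurable_iverson; apply: measurable_and; first exact: measurable_all_le.
  by apply: (measurable_count_tuple k (f := fun p : 1.-tuple T * m.-tuple T => thead p.1 - eps) (g := snd)) => //; exact: measurable_funB.
- rewrite (_ : (fun _ => _) = cst 0%E); first exact: measurable_cst.
  by apply/funext => -[u v]; case/tupleP: u => a u; case/tupleP: u => b u.
Qed.

(** Without ties only the index of the maximum [M] contributes. Counting [M] along with the others
    changes [k] into [k.+1]. *)
Lemma sum_one_hot n (t : n.-tuple R) (M : R) (g : R -> R) (eps : R) k :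
  uniq t -> M \in (t : seq R) -> (forall y, y \in (t : seq R) -> y <= M) -> 0 <= eps ->
  (\sum_(A : {set 'I_n}) one_hot g eps k
     (mask (mask_of A) t) (mask (map negb (mask_of A)) t) =
   (g M)%:E * iverson (k.+1 <= count (fun y => M - eps <= y)%R t)%N)%E.
Proof.
move=> ut Mt tM e0.
rewrite (bigD1 (index_set (pred1 M) t))//= big1 => [|A nA].
  rewrite adde0 mask_index_set maskN_index_set filter_pred1_uniq//=.
  congr (_ * iverson _)%E.
  rewrite (_ : all _ _ = true)/=; last first.
    by apply/allP => y; rewrite mem_filter => /andP[_ /tM].
  rewrite -[in RHS](permP (permEl (perm_filterC (pred1 M) t))).
  by rewrite count_cat filter_pred1_uniq//= gerBl e0.
have pm := perm_mask_split (b := mask_of A) (s := t).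
move: nA; rewrite /one_hot.
case E : (mask (mask_of A) t) => [|y [|//]]// nA; set v := mask _ _.
have {}pm : perm_eq (y :: v) t.
  by have := pm; rewrite E !size_tuple => /(_ erefl).
case: (boolP (all _ v)) => [/allP vy|_]; last by rewrite andFb mule0.
have yM : y = M.
  apply/le_anti; rewrite tM -?(perm_mem pm) ?mem_head//=.
  by move: Mt; rewrite -(perm_mem pm) inE => /predU1P[->//|/vy].
move: nA; rewrite (@index_set_eq _ _ (pred1 M) A t) ?eqxx//.
  by rewrite E/= yM eqxx.
apply/allP => z zv /=; apply/negP => /eqP zM.
by move: ut; rewrite -(perm_uniq pm)/= yM -zM zv.
Qed.

(** Second splitting, of the coordinates other than the maximum [y]: [u] collects those in
    [y - eps, y] and [v] those below. *)
Definition window (y eps : R) (k : nat) (u v : seq R) : \bar R :=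
  iverson [&& (k <= size u)%N, all (fun z => (y - eps <= z) && (z <= y)) u &
              all (fun z => z < y - eps) v].

Lemma sum_window n (t : n.-tuple R) (y eps : R) k : 0 <= eps ->
  (\sum_(A : {set 'I_n}) window y eps k
     (mask (mask_of A) t) (mask (map negb (mask_of A)) t) =
   iverson (all (fun z => z <= y)%R t && (k <= count (fun z => y - eps <= z)%R t)%N))%E.
Proof.
move=> e0.
have predE : predC (fun z : R => y - eps <= z) =1 (fun z => z < y - eps).
  by move=> z /=; rewrite ltNge.
rewrite (bigD1 (index_set (fun z => y - eps <= z) t))//= big1 => [|A nA].
  rewrite adde0 mask_index_set maskN_index_set (eq_filter predE).
  rewrite /window filter_all andbT size_filter andbC; congr (iverson (_ && _)).
  rewrite -(perm_all _ (permEl (perm_filterC (fun z => y - eps <= z) t))) all_cat.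
  rewrite [X in _ && X](_ : _ = true) ?andbT; last first.
    apply/allP => z; rewrite mem_filter predE => /andP[/ltW zy _].
    by rewrite (le_trans zy)// gerBl.
  by apply/eq_in_all => z; rewrite mem_filter => /andP[-> _].
rewrite /window; case: (boolP [&& _, _ & _]) => // /and3P[_ /allP hu hv].
move: nA; rewrite (@index_set_eq _ _ (fun z => y - eps <= z) A t) ?eqxx//.
  by apply/allP => z /hu /andP[].
by rewrite (eq_all predE).
Qed.

Variable mu : {sigma_finite_measure set T -> \bar R}.

Lemma integral_all_tuple n (p : T -> bool) (c : R) : measurable_fun setT p ->
  mu [set z | p z] = c%:E ->
  (\int[tuple_power mu n]_t iverson (all p t) = (c ^+ n)%:E)%E.
Proof.
move=> mp pc.
rewrite -(@integral_prod_tuple _ _ _ mu n (fun z => (p z)%:R) c)//; last 2 first.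
- rewrite (_ : (fun _ => _) = fun z => if p z then 1 else 0 : R).
    exact: measurable_fun_ifT.
  by apply/funext => z; case: ifP.
- by rewrite -pc -integral_iverson.
apply: eq_integral => t _; rewrite /iverson; congr EFin.
elim: (t : seq _) => [|y s IH]; first by rewrite big_nil.
by rewrite big_cons -IH /= -mulnb natrM.
Qed.

Variables (y eps D F : R).
Hypothesis eps0 : 0 <= eps.
Hypothesis muD : mu [set z | (y - eps <= z) && (z <= y)] = D%:E.
Hypothesis muF : mu [set z | z < y - eps] = F%:E.

Let mpD : measurable_fun setT (fun z : T => (y - eps <= z) && (z <= y)).
Proof. by apply: measurable_and; exact: measurable_fun_ler. Qed.

Let mpF : measurable_fun setT (fun z : T => z < y - eps).
Proof. exact: measurable_fun_ltr. Qed.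

Let mD m : measurable_fun setT
  (fun t : m.-tuple T => all (fun z => (y - eps <= z) && (z <= y)) t).
Proof.
apply: (measurable_all_tuple (h := fun _ z => (y - eps <= z) && (z <= y)) (g := id)) => //.
exact: (measurableT_comp mpD measurable_snd).
Qed.

Let mF m : measurable_fun setT (fun t : m.-tuple T => all (fun z => z < y - eps) t).
Proof.
apply: (measurable_all_tuple (h := fun _ z => z < y - eps) (g := id)) => //.
exact: (measurableT_comp mpF measurable_snd).
Qed.

(** A binomial tail: each coordinate falls into the window with weight [D] or below it with weight
    [F], and at least [k] must fall into the window. *)
Lemma integral_window m k :
  (\int[tuple_power mu m]_t iverson (all (fun z => z <= y)%R t &&
      (k <= count (fun z => y - eps <= z)%R t)%N) =
   (\sum_(j < m.+1) 'C(m, j)%:R * ((k <= j)%N%:R * (D ^+ j * F ^+ (m - j))))%:E)%E.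
Proof.
transitivity (\int[tuple_power mu m]_t (\sum_(A : {set 'I_m}) window y eps k
     (mask (mask_of A) t) (mask (map negb (mask_of A)) t)))%E.
  by apply: eq_integral => t _; rewrite sum_window.
rewrite integral_sum_mask; last 2 first.
- move=> i l; apply: measurable_iverson.
  rewrite (_ : (fun _ => _) = fun p : i.-tuple T * l.-tuple T => (k <= i)%N &&
    (all (fun z => (y - eps <= z) && (z <= y)) p.1 && all (fun z => z < y - eps) p.2)).
    apply: measurable_and; first exact: measurable_cst.
    apply: measurable_and.
      apply: (measurable_all_tuple (h := fun (_ : i.-tuple T * l.-tuple T) z =>
        (y - eps <= z) && (z <= y)) (g := fst)) => //.
      exact: (measurableT_comp mpD measurable_snd).
    apply: (measurable_all_tuple (h := fun (_ : i.-tuple T * l.-tuple T) z =>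
      z < y - eps) (g := snd)) => //.
    exact: (measurableT_comp mpF measurable_snd).
  by apply/funext => p; rewrite size_tuple.
- by move=> u v; exact: iverson_ge0.
rewrite -sumEFin; apply: eq_bigr => j _; rewrite EFinM; congr (_ * _)%E.
transitivity (\int[tuple_power mu j]_u ((k <= j)%N%:R%:E *
    iverson (all (fun z => (y - eps <= z) && (z <= y))%R u) * (F ^+ (m - j))%:E))%E.
  apply: eq_integral => u _.
  rewrite -(integral_all_tuple (m - j) mpF muF) -ge0_integralZl//; last 2 first.
  - by apply: measurable_iverson; exact: mF.
  - by rewrite mule_ge0// lee_fin.
  apply: eq_integral => v _; rewrite /window size_tuple !iverson_and -muleA.
  by [].
have F0 : 0 <= F by rewrite -lee_fin -muF.
have mI : measurable_fun setT (fun u : j.-tuple T =>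
    iverson (all (fun z => (y - eps <= z) && (z <= y))%R u) : \bar R).
  by apply: measurable_iverson; exact: mD.
rewrite ge0_integralZr//; last 3 first.
- exact: measurable_funeM.
- by move=> u _; rewrite mule_ge0// lee_fin.
- by rewrite lee_fin exprn_ge0.
by rewrite ge0_integralZl_EFin// (integral_all_tuple j mpD muD) -!EFinM mulrA.
Qed.

End window.

(** * The expectation as a one-dimensional integral *)

Section gap_expectation.
Context {R : realType}.
Local Notation mu := (@lebesgue_measure R).
Local Notation T := (measurableTypeR R).
Local Notation N01 := (normal_prob (0 : R) 1).

Lemma normal_prob_set1 (x : T) : N01 [set x] = 0%E.
Proof. by rewrite /normal_prob integral_set1. Qed.

Lemma normal_prob_below (c : R) : N01 [set z | z < c] = (std_cdf c)%:E.
Proof.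
rewrite -normal_prob_itvNy (_ : [set z | z < c] = `]-oo, c[%classic); last first.
  by apply/seteqP; split => z /=; rewrite in_itv.
rewrite /normal_prob integral_itv_bndo_bndc//.
by apply/measurable_funTS/measurable_EFinP; exact: measurable_normal_pdf.
Qed.

Lemma normal_prob_window (y eps : R) : 0 <= eps ->
  N01 [set z | (y - eps <= z) && (z <= y)] = (std_cdf y - std_cdf (y - eps))%:E.
Proof.
move=> e0; have mlt (c : R) : measurable [set z : T | z < c].
  by apply: measurable_set_of_bool; exact: measurable_fun_ltr.
have mw : measurable [set z : T | (y - eps <= z) && (z <= y)].
  apply: measurable_set_of_bool.
  by apply: measurable_and; exact: measurable_fun_ler.
have : N01 `]-oo, y]%classic =
    (N01 [set z : T | (z < y - eps)%R] +
     N01 [set z : T | ((y - eps <= z) && (z <= y))%R])%E.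
  rewrite -measureU//; last first.
    by apply/seteqP; split => // z [/= h /andP[h' _]]; move: h; rewrite ltNge h'.
  congr (N01 _); apply/seteqP; split => z /=; rewrite in_itv/=.
    by move=> zy; have [h|h] := leP (y - eps) z; [right; apply/andP|left].
  by move=> [/ltW h|/andP[]//]; rewrite (le_trans h)// gerBl.
rewrite normal_prob_below normal_prob_itvNy.
have : N01 [set z | (y - eps <= z) && (z <= y)] \is a fin_num.
  exact: fin_num_measure.
by case: (N01 _) => // r _ [->]; rewrite addrAC subrr add0r.
Qed.

Definition cdf_incr (eps y : R) : R := std_cdf y - std_cdf (y - eps).

Lemma cdf_incr_ge0 eps y : 0 <= eps -> 0 <= cdf_incr eps y.
Proof. by move=> e0; rewrite -lee_fin -normal_prob_window. Qed.

Lemma cdf_incr_le1 eps y : 0 <= eps -> cdf_incr eps y <= 1.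
Proof.
move=> e0; rewrite /cdf_incr lerBlDr (le_trans (std_cdf_le1 _))// lerDl.
exact: std_cdf_ge0.
Qed.

(** The density is at most 1. This bound lets [eps ^- k] be absorbed uniformly in [y]. *)
Lemma cdf_incr_le eps y : 0 <= eps -> cdf_incr eps y <= eps.
Proof.
move=> e0; rewrite -lee_fin -normal_prob_window//.
rewrite (_ : [set z | _] = `[y - eps, y]%classic); last first.
  by apply/seteqP; split => z /=; rewrite in_itv.
apply: (@le_trans _ _ (\int[mu]_(x in `[(y - eps)%R, y]) (cst 1%E x))%E).
  apply: ge0_le_integral => //.
  - by move=> x _; rewrite lee_fin normal_pdf_ge0.
  - by apply/measurable_funTS/measurable_EFinP; exact: measurable_normal_pdf.
  - by move=> x _; rewrite lee_fin; exact: std_pdf_le1.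
rewrite integral_cst//= mul1e lebesgue_measure_itv/= lte_fin.
by case: ifPn => _; [rewrite -EFinD lee_fin opprB addrC subrK|exact: e0].
Qed.

Lemma measurable_cdf_incr eps : measurable_fun setT (cdf_incr eps).
Proof.
apply: measurable_funB; first exact: measurable_std_cdf.
apply: (measurableT_comp measurable_std_cdf).
exact: measurable_funB.
Qed.

(** The probability that m independent standard normal variables are all at most [y] with at least
    [k] of them in [y - eps, y]. *)
Definition gap_weight m k (eps y : R) : R :=
  \sum_(j < m.+1) 'C(m, j)%:R *
    ((k <= j)%N%:R * (cdf_incr eps y ^+ j * std_cdf (y - eps) ^+ (m - j))).

Lemma gap_weight_ge0 m k eps y : 0 <= eps -> 0 <= gap_weight m k eps y.
Proof.
move=> e0; apply: sumr_ge0 => j _.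
by rewrite !mulr_ge0 ?exprn_ge0 ?std_cdf_ge0 ?cdf_incr_ge0.
Qed.

Lemma measurable_gap_weight m k eps : measurable_fun setT (gap_weight m k eps).
Proof.
apply: measurable_sum => j; apply: measurable_funM => //.
apply: measurable_funM => //; apply: measurable_funM; apply: measurable_funX.
  exact: measurable_cdf_incr.
apply: (measurableT_comp measurable_std_cdf).
exact: measurable_funB.
Qed.

Lemma codom_tnth n (t : n.-tuple R) : codom (tnth t) = t.
Proof. by rewrite codomE map_tnth_enum. Qed.

Lemma measurable_max_coord m :
  measurable_fun setT (fun t : m.+1.-tuple T => max_coord (tnth t)).
Proof.
rewrite (_ : (fun _ => _) = fun t : m.+1.-tuple T =>
    \big[Num.max/thead t]_(i < m.+1) tnth t i); last first.
  apply/funext => t; rewrite /max_coord codom_tnth; congr bigop.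
  by case/tupleP: t.
elim: (index_enum _) => [|i s IH].
  by under eq_fun do rewrite big_nil; exact: measurable_tnth.
under eq_fun do rewrite big_cons.
by apply: measurable_maxr => //; exact: measurable_tnth.
Qed.

Definition many_near_max m k (eps : R) (t : m.+1.-tuple T) : bool :=
  (k.+1 <= count (fun y => max_coord (tnth t) - eps <= y)%R t)%N.

Lemma measurable_many_near_max m k eps :
  measurable_fun setT (@many_near_max m k eps).
Proof.
apply: (measurable_count_tuple k.+1
  (f := fun t : m.+1.-tuple T => max_coord (tnth t) - eps) (g := id)) => //.
by apply: measurable_funB => //; exact: measurable_max_coord.
Qed.

Lemma ge0_integral_gap m k eps (g : R -> R) : measurable_fun setT g ->
  (forall y, 0 <= g y) -> 0 <= eps ->
  (\int[tuple_power N01 m.+1]_t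
     ((g (max_coord (tnth t)))%:E * iverson (many_near_max k eps t)) =
   \int[N01]_y (g y * (m.+1%:R * gap_weight m k eps y))%:E)%E.
Proof.
move=> mg g0 e0.
have mO := seq_measurable_one_hot eps k mg.
have O0 u v : (0 <= one_hot g eps k u v)%E by exact: one_hot_ge0.
transitivity (\int[tuple_power N01 m.+1]_t (\sum_(A : {set 'I_m.+1})
    one_hot g eps k (mask (mask_of A) t) (mask (map negb (mask_of A)) t)))%E.
  apply: (integral_uniq_eq normal_prob_set1).
  - apply: emeasurable_funM.
      apply/measurable_EFinP; apply: (measurableT_comp mg).
      exact: measurable_max_coord.
    by apply: measurable_iverson; exact: measurable_many_near_max.
  - by apply: emeasurable_sum => A; exact: seq_measurable_mask.
  move=> t ut; rewrite (@sum_one_hot _ _ t (max_coord (tnth t)))//.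
    by rewrite -[X in _ \in X]codom_tnth; exact: max_coord_mem.
  by move=> y; rewrite -[X in _ \in X]codom_tnth; exact: max_coord_ge.
rewrite integral_sum_mask//.
have i1 : (1 < m.+2)%N by [].
(* Only index sets of cardinality 1 contribute; their number gives the factor m + 1. *)
rewrite (bigD1 (Ordinal i1))//= big1 ?adde0; last first.
  move=> j j1; rewrite [double_integral _ _ _ _](_ : _ = 0%E) ?mule0//.
  apply: integral0_eq => u _; apply: integral0_eq => v _.
  move: j1 (size_tuple u); rewrite -val_eqE/=.
  by case: (u : seq _) => [|a [|b s]] //= j1 su; case: (elimN eqP j1 (esym su)).
rewrite bin1 subn1/= /double_integral integral_tuple_powerS; last 2 first.
- have := mO 1%N m.
  move/(measurable_fun_fubini_tonelli_F (m2 := tuple_power N01 m)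
    (fun p : 1.-tuple T * m.-tuple T => one_hot g eps k p.1 p.2)); exact.
- by move=> u; exact: integral_ge0.
transitivity (m.+1%:R%:E * \int[N01]_y (g y * gap_weight m k eps y)%:E)%E.
  congr (_ * _)%E; apply: eq_integral => y _.
  rewrite integral_tuple_power0; last by move=> t; exact: integral_ge0.
  rewrite /one_hot/= ge0_integralZl_EFin//; last first.
    apply: measurable_iverson; apply: measurable_and.
      exact: (measurable_all_le (f := cst y)).
    exact: (measurable_count_tuple k (f := cst (y - eps))).
  by rewrite (integral_window e0 (normal_prob_window y e0) (normal_prob_below _)).
rewrite -ge0_integralZl_EFin//; last 2 first.
- by move=> y _; rewrite lee_fin mulr_ge0// gap_weight_ge0.
- apply/measurable_EFinP; apply: measurable_funM => //.
  exact: measurable_gap_weight.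
by apply: eq_integral => y _; rewrite -EFinM mulrCA.
Qed.

Lemma integral_gap m k eps : 0 <= eps ->
  (\int[tuple_power N01 m.+1]_t
     (max_coord (tnth t) * (many_near_max k eps t)%:R)%:E =
   \int[mu]_y (y * (m.+1%:R * gap_weight m k eps y) * std_pdf y)%:E)%E.
Proof.
move=> e0; have w0 y : 0 <= m.+1%:R * gap_weight m k eps y.
  by rewrite mulr_ge0// gap_weight_ge0.
rewrite -integral_normal_prob; last first.
  by apply: measurable_funM => //; apply: measurable_funM => //; exact: measurable_gap_weight.
(* The maximum may be negative, so its positive and negative parts are treated as two choices of [g]
   in [ge0_integral_gap]. *)
rewrite integralE [RHS]integralE; congr (_ - _)%E.
  transitivity (\int[tuple_power N01 m.+1]_t
      ((Num.max (max_coord (tnth t)) 0)%:E * iverson (many_near_max k eps t)))%E.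
    apply: eq_integral => t _; rewrite funeposE /iverson.
    by case: (many_near_max _ _ _); rewrite ?mulr1 ?mule1 ?EFin_max// mulr0 mule0 maxxx.
  rewrite (@ge0_integral_gap _ _ _ (fun y => Num.max y 0))//; last 2 first.
  - exact: measurable_maxr.
  - by move=> y; rewrite le_max lexx orbT.
  by apply: eq_integral => y _; rewrite funeposE maxr_pMl// mul0r EFin_max.
transitivity (\int[tuple_power N01 m.+1]_t
    ((Num.max (- max_coord (tnth t)) 0)%:E * iverson (many_near_max k eps t)))%E.
  apply: eq_integral => t _; rewrite funenegE /iverson.
  by case: (many_near_max _ _ _); rewrite ?mulr1 ?mule1 ?EFin_max// mulr0 oppe0 mule0 maxxx.
rewrite (@ge0_integral_gap _ _ _ (fun y => Num.max (- y) 0))//; last 2 first.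
- by apply: measurable_maxr => //; exact: measurableT_comp.
- by move=> y; rewrite le_max lexx orbT.
by apply: eq_integral => y _; rewrite funenegE maxr_pMl// mul0r EFin_max mulNr.
Qed.

Lemma expectation_gap m k eps d (Omega : measurableType d)
    (P : probability Omega R) (xi : 'I_m.+1 -> {RV P >-> R}) :
  (k <= m)%N -> 0 <= eps -> mutually_independent xi ->
  (forall i, standard_normal (xi i)) ->
  ('E_P[fun w => (max_coord (fun i => xi i w) *
                  \1_(top_gap_event xi k.+1 eps) w)%R] =
   \int[mu]_y (y * (m.+1%:R * gap_weight m k eps y) * std_pdf y)%:E)%E.
Proof.
move=> km e0 indep normal; rewrite -integral_gap//.
rewrite -(expectation_joint indep normal); last first.
  apply: measurable_funM; first exact: measurable_max_coord.
  rewrite (_ : (fun _ => _) = fun t => if many_near_max k eps t then 1 else 0 : R).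
    by apply: measurable_fun_ifT => //; exact: measurable_many_near_max.
  by apply/funext => t; case: (many_near_max _ _ _).
congr expectation; apply/funext => w /=.
have xE : tnth (joint xi w) = (fun i => xi i w).
  by apply/funext => i; rewrite tnth_mktuple.
rewrite xE; congr (_ * (nat_of_bool _)%:R).
rewrite /many_near_max xE -[X in count _ X]codom_tnth xE -top_gapE//.
by apply/idP/idP; rewrite inE.
Qed.

End gap_expectation.

(** * The limit *)

Section gap_limit.
Context {R : realType}.
Local Notation mu := (@lebesgue_measure R).
Local Notation T := (measurableTypeR R).

Lemma cvg_sum_seq (I : Type) (s : seq I) (f : I -> R^nat) (l : I -> R) :
  (forall i, f i n @[n --> \oo] --> l i) ->
  \sum_(i <- s) f i n @[n --> \oo] --> \sum_(i <- s) l i.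
Proof.
move=> fl; elim: s => [|i s IH].
  by under eq_fun do rewrite big_nil; rewrite big_nil; exact: cvg_cst.
under eq_fun do rewrite big_cons.
by rewrite big_cons; apply: cvgD; [exact: fl|exact: IH].
Qed.

Lemma cvg_exprn_seq (f : R^nat) (l : R) j :
  f n @[n --> \oo] --> l -> f n ^+ j @[n --> \oo] --> l ^+ j.
Proof. by move=> fl; exact: (cvg_comp f (fun z => z ^+ j) fl (@exprn_continuous R j l)). Qed.

(** Only j >= k occurs, so [eps ^- k] can be distributed over k of the increments, leaving quotients
    that stay bounded. *)
Lemma gap_weightE m k (eps y : R) : (k <= m)%N -> 0 < eps ->
  eps ^- k * gap_weight m k eps y =
  \sum_(j < m.+1) 'C(m, j)%:R * ((k <= j)%N%:R *
    ((cdf_incr eps y / eps) ^+ k * cdf_incr eps y ^+ (j - k) * std_cdf (y - eps) ^+ (m - j))).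
Proof.
move=> km e0; rewrite /gap_weight mulr_sumr; apply: eq_bigr => j _.
rewrite mulrCA; congr (_ * _); rewrite mulrCA.
case: leqP => [kj|_]; last by rewrite !mul0r.
congr (_ * _); rewrite -{1}(subnKC kj) exprD expr_div_n.
by rewrite -!mulrA mulrCA.
Qed.

(** Every factor next to a binomial coefficient is at most 1, and the coefficients add up to 2 ^
    m. *)
Lemma gap_weight_bound m k (eps y : R) : (k <= m)%N -> 0 < eps ->
  0 <= eps ^- k * gap_weight m k eps y <= 2 ^+ m.
Proof.
move=> km e0; have e0' := ltW e0.
have D0 := cdf_incr_ge0 y e0'; have D1 := cdf_incr_le1 y e0'.
have F0 := std_cdf_ge0 (y - eps); have F1 := std_cdf_le1 (y - eps).
have q0 : 0 <= cdf_incr eps y / eps by rewrite divr_ge0.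
have q1 : cdf_incr eps y / eps <= 1 by rewrite ler_pdivrMr// mul1r cdf_incr_le.
rewrite mulr_ge0 ?invr_ge0 ?exprn_ge0 ?gap_weight_ge0//= gap_weightE//.
have -> : (2 ^+ m : R) = \sum_(j < m.+1) 'C(m, j)%:R.
  rewrite -[2]/(1 + 1) exprDn; apply: eq_bigr => j _.
  by rewrite !expr1n mulr1.
apply: ler_sum => j _; rewrite ler_piMr//.
case: (k <= j)%N; last by rewrite mul0r.
rewrite mul1r mulr_ile1 ?mulr_ge0 ?exprn_ge0//; last exact: exprn_ile1.
by rewrite mulr_ile1 ?exprn_ge0// exprn_ile1.
Qed.

Section along_a_sequence.
Variable u : R^nat.
Hypotheses (u0 : forall n, 0 < u n) (ul : u n @[n --> \oo] --> (0 : R)).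

Lemma cvg_cdf_shift y : std_cdf (y - u n) @[n --> \oo] --> std_cdf y.
Proof.
have h : y - u n @[n --> \oo] --> y - 0.
  by apply: cvgB; [exact: cvg_cst|exact: ul].
rewrite subr0 in h.
exact: (cvg_comp (fun n => y - u n) std_cdf h (@continuous_std_cdf R y)).
Qed.

Lemma cvg_cdf_incr_quot y : cdf_incr (u n) y / u n @[n --> \oo] --> std_pdf y.
Proof.
have [df dE] := is_derive_std_cdf y.
have dq : (fun h => h^-1 *: (std_cdf (h *: (1 : R) + y) - std_cdf y)) @ 0^' --> std_pdf y.
  by rewrite -dE; exact: df.
(* The quotient is the difference quotient of the distribution function with increment [- u n],
   which tends to 0 without taking the value 0. *)
have nu : (fun n => - u n) @ \oo --> (0 : R)^'.
  have nu0 : (fun n => - u n) @ \oo --> (0 : R).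
    by rewrite -oppr0; apply: cvgN; exact: ul.
  move=> A A0; have [N _ h] := nu0 _ A0.
  by exists N => // n /h /=; apply; rewrite oppr_eq0 gt_eqF.
have := cvg_comp _ _ nu dq.
rewrite (_ : _ \o _ = fun n => cdf_incr (u n) y / u n)//.
apply/funext => n /=; rewrite /cdf_incr -[LHS]/((- u n)^-1 * (std_cdf (- u n * 1 + y) - std_cdf y)).
rewrite mulr1 [- u n + y]addrC invrN; ring.
Qed.

Lemma cvg_cdf_incr y : cdf_incr (u n) y @[n --> \oo] --> (0 : R).
Proof.
rewrite -(subrr (std_cdf y)); apply: cvgB; first exact: cvg_cst.
exact: cvg_cdf_shift.
Qed.

(** Terms with j > k keep a positive power of an increment tending to 0, so only j = k survives. *)
Lemma cvg_gap_weight m k y : (k <= m)%N ->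
  u n ^- k * gap_weight m k (u n) y @[n --> \oo] -->
  'C(m, k)%:R * (std_pdf y ^+ k * std_cdf y ^+ (m - k)).
Proof.
move=> km.
under eq_fun do rewrite gap_weightE//.
have -> : 'C(m, k)%:R * (std_pdf y ^+ k * std_cdf y ^+ (m - k)) =
  \sum_(j < m.+1) 'C(m, j)%:R * ((k <= j)%N%:R *
    (std_pdf y ^+ k * 0 ^+ (j - k) * std_cdf y ^+ (m - j))) :> R.
  have km1 : (k < m.+1)%N by [].
  rewrite (bigD1 (Ordinal km1))//= leqnn subnn expr0 mulr1 mul1r big1 ?addr0//.
  move=> j; rewrite -val_eqE/= => jk; case: leqP => [kj|_]; last by rewrite mul0r mulr0.
  by rewrite expr0n subn_eq0 leqNgt ltn_neqAle eq_sym jk kj/= mulr0 mul0r !mulr0.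
apply: cvg_sum_seq => j; apply: cvgMr; apply: cvgMr.
apply: cvgM; last by apply: cvg_exprn_seq; exact: cvg_cdf_shift.
apply: cvgM; apply: cvg_exprn_seq; first exact: cvg_cdf_incr_quot.
exact: cvg_cdf_incr.
Qed.

End along_a_sequence.

Definition scaled_gap m k (eps y : R) : R :=
  y * (m.+1%:R * (eps ^- k * gap_weight m k eps y)) * std_pdf y.

Definition gap_density m k (y : R) : R :=
  y * (m.+1%:R * ('C(m, k)%:R * (std_pdf y ^+ k * std_cdf y ^+ (m - k)))) * std_pdf y.

Lemma measurable_scaled_gap m k eps : measurable_fun setT (scaled_gap m k eps).
Proof.
apply: measurable_funM; last exact: measurable_std_pdf.
apply: measurable_funM => //; apply: measurable_funM => //.
by apply: measurable_funM => //; exact: measurable_gap_weight.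
Qed.

Lemma measurable_gap_density m k : measurable_fun setT (gap_density m k).
Proof.
apply: measurable_funM; last exact: measurable_std_pdf.
apply: measurable_funM => //; apply: measurable_funM => //.
apply: measurable_funM => //; apply: measurable_funM; apply: measurable_funX.
  exact: measurable_std_pdf.
exact: measurable_std_cdf.
Qed.

Lemma scaled_gap_bound m k eps y : (k <= m)%N -> 0 < eps ->
  `|scaled_gap m k eps y| <= m.+1%:R * 2 ^+ m * `|y * std_pdf y|.
Proof.
move=> km e0; have /andP[w0 w1] := gap_weight_bound y km e0.
rewrite /scaled_gap; move: (_ * gap_weight _ _ _ _) w0 w1 => w w0 w1.
rewrite !normrM (ger0_norm (std_pdf_ge0 y)) (ger0_norm w0) normr_nat.
rewrite [leRHS]mulrA ler_wpM2r ?std_pdf_ge0// [leRHS]mulrC ler_wpM2l//.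
exact: ler_wpM2l.
Qed.

Lemma integrable_scaled_gap m k eps : (k <= m)%N -> 0 < eps ->
  mu.-integrable setT (fun y => (scaled_gap m k eps y)%:E).
Proof.
move=> km e0.
have ic : mu.-integrable setT (fun y => (m.+1%:R * 2 ^+ m)%:E * (y * std_pdf y)%:E)%E.
  exact/integrableZl/integrable_xstd_pdf.
apply: (le_integrable measurableT _ _ ic).
- by apply/measurable_EFinP; exact: measurable_scaled_gap.
- move=> y _; rewrite -EFinM lee_fin (le_trans (scaled_gap_bound y km e0))//.
  by rewrite [leRHS]normrM ger0_norm// mulr_ge0// exprn_ge0.
Qed.

Lemma cvg_integral_scaled_gap m k : (k <= m)%N ->
  fine (\int[mu]_y (scaled_gap m k eps y)%:E)%E @[eps --> (0 : R)^'+] -->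
  fine (\int[mu]_y (gap_density m k y)%:E)%E.
Proof.
(* The one-sided limit is tested along sequences, to which dominated convergence applies; [g]
   dominates for every positive [eps]. *)
move=> km; apply/cvg_at_rightP => u [u0 ul].
pose g (y : T) : \bar R := (m.+1%:R * 2 ^+ m * `|y * std_pdf y|)%:E.
have ig : mu.-integrable setT g.
  rewrite (_ : g = fun y => (m.+1%:R * 2 ^+ m)%:E * `|(y * std_pdf y)%:E|)%E.
    by apply: integrableZl => //; apply: integrable_abse; exact: integrable_xstd_pdf.
  by apply/funext => y; rewrite /g EFinM.
have ptw (y : T) : setT y ->
    (scaled_gap m k (u n) y)%:E @[n --> \oo] --> (gap_density m k y)%:E.
  move=> _; apply: cvg_EFin; first exact: nearW.
  rewrite /gap_density /scaled_gap; apply: cvgMl; apply: cvgMr; apply: cvgMr.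
  exact: cvg_gap_weight.
have bnd (y : T) n : setT y -> (`|(scaled_gap m k (u n) y)%:E| <= g y)%E.
  by move=> _; rewrite lee_fin scaled_gap_bound.
have [idens _ cg] := @dominated_convergence _ T R mu setT measurableT
  (fun n y => (scaled_gap m k (u n) y)%:E) (fun y => (gap_density m k y)%:E) g
  (fun n => (measurable_EFinP _ _).2 (measurable_scaled_gap m k (u n)))
  ((measurable_EFinP _ _).2 (measurable_gap_density m k))
  (aeW _ ptw) ig (aeW _ bnd).
by apply: fine_cvg; rewrite fineK//; exact: integrable_fin_num idens.
Qed.

End gap_limit.

(** * Integration by parts over the whole line *)

Section by_parts.
Context {R : realType}.
Local Notation mu := (@lebesgue_measure R).
Local Notation T := (measurableTypeR R).

Definition pdf_cdf a b (y : R) : R := std_pdf y ^+ a * std_cdf y ^+ b.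

Lemma continuous_pdf_cdf a b : continuous (pdf_cdf a b).
Proof.
move=> y; apply: cvgM.
  by apply: (cvg_comp std_pdf (fun z => z ^+ a)); [exact: continuous_std_pdf|exact: exprn_continuous].
by apply: (cvg_comp std_cdf (fun z => z ^+ b)); [exact: continuous_std_cdf|exact: exprn_continuous].
Qed.

(** The derivative of phi^(a+1) Phi^(b+1), using phi'(y) = - y phi(y) and Phi' = phi. *)
Definition dpdf_cdf a b (y : R) : R :=
  b.+1%:R * pdf_cdf a.+2 b y - a.+1%:R * (y * pdf_cdf a.+1 b.+1 y).

Lemma dpdf_cdfE a b : (fun y => (dpdf_cdf a b y)%:E) = (fun y =>
  b.+1%:R%:E * (pdf_cdf a.+2 b y)%:E - a.+1%:R%:E * (y * pdf_cdf a.+1 b.+1 y)%:E)%E.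
Proof. by apply/funext => y; rewrite -!EFinM -EFinB. Qed.

Lemma is_derive_pdf_cdf a b (y : R) :
  is_derive y (1 : R) (pdf_cdf a.+1 b.+1) (dpdf_cdf a b y).
Proof.
have dp := is_derive_std_pdf y; have dc := is_derive_std_cdf y.
have -> : pdf_cdf a.+1 b.+1 = (@std_pdf R ^+ a.+1) * (@std_cdf R ^+ b.+1).
  by apply/funext => z; rewrite /pdf_cdf !fctE.
apply: is_derive_eq.
rewrite !fctE /GRing.scale/= /dpdf_cdf /pdf_cdf !exprS; ring.
Qed.

Lemma continuous_dpdf_cdf a b : continuous (dpdf_cdf a b).
Proof.
move=> y; apply: cvgB; apply: cvgMr; first exact: continuous_pdf_cdf.
by apply: cvgM; [exact: cvg_id|exact: continuous_pdf_cdf].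
Qed.

Lemma pdf_cdf_ge0 a b y : 0 <= pdf_cdf a b y.
Proof. by rewrite mulr_ge0// exprn_ge0 ?std_pdf_ge0 ?std_cdf_ge0. Qed.

Lemma pdf_cdf_le_pdf a b y : pdf_cdf a.+1 b y <= std_pdf y.
Proof.
rewrite /pdf_cdf exprS -mulrA ler_piMr ?std_pdf_ge0// mulr_ile1 ?exprn_ge0 ?std_pdf_ge0 ?std_cdf_ge0//.
  by rewrite exprn_ile1 ?std_pdf_ge0 ?std_pdf_le1.
by rewrite exprn_ile1 ?std_cdf_ge0 ?std_cdf_le1.
Qed.

Lemma measurable_pdf_cdf a b : measurable_fun setT (pdf_cdf a b).
Proof. exact: (continuous_measurable_fun (@continuous_pdf_cdf a b)). Qed.

Lemma integrable_pdf_cdf a b : mu.-integrable setT (fun y => (pdf_cdf a.+1 b y)%:E).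
Proof.
apply: (le_integrable measurableT _ _ (integrable_normal_pdf 0 1)).
- by apply/measurable_EFinP; exact: measurable_pdf_cdf.
- move=> x _; rewrite lee_fin !ger0_norm ?pdf_cdf_ge0 ?normal_pdf_ge0//.
  exact: pdf_cdf_le_pdf.
Qed.

Lemma integrable_xpdf_cdf a b : mu.-integrable setT (fun y => (y * pdf_cdf a.+1 b y)%:E).
Proof.
apply: (le_integrable measurableT _ _ integrable_xstd_pdf).
- apply/measurable_EFinP; apply: measurable_funM => //.
  exact: measurable_pdf_cdf.
- move=> x _; rewrite lee_fin normrM [leRHS]normrM ler_wpM2l//.
  by rewrite !ger0_norm ?pdf_cdf_ge0 ?std_pdf_ge0// pdf_cdf_le_pdf.
Qed.

(** A crude decay rate, from exp t >= 1 + t, that compares the boundary terms with the harmonic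
    sequence. *)
Lemma std_pdf_le_inv (y : R) : 1 <= `|y| -> std_pdf y <= 2 * `|y|^-1.
Proof.
move=> y1; have y0 : 0 < `|y| by exact: lt_le_trans y1.
rewrite std_pdfE; apply: (@le_trans _ _ (expR (- (y ^+ 2 / 2)))).
  rewrite ler_piMl ?expR_ge0// invf_le1 ?sqrt2pi_gt0//.
  rewrite -[leLHS]sqrtr1 ler_wsqrtr// -mulr_natr; have := pi_ge2 R; lra.
rewrite expRN -[leRHS]invrK lef_pV2 ?posrE ?expR_gt0 ?invr_gt0 ?mulr_gt0 ?invr_gt0//.
apply: le_trans (expR_ge1Dx _).
rewrite invfM invrK -real_normK ?num_real//.
by nra.
Qed.

(** The integrals over growing symmetric intervals tend to the whole integral by domination, and to
    0 because the boundary values vanish at infinity. *)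
Lemma integral_dpdf_cdf a b : (\int[mu]_y (dpdf_cdf a b y)%:E = 0)%E.
Proof.
have id : mu.-integrable setT (fun y => (dpdf_cdf a b y)%:E).
  rewrite dpdf_cdfE; apply: integrableB => //; apply: integrableZl => //.
    exact: integrable_pdf_cdf.
  exact: integrable_xpdf_cdf.
pose F := pdf_cdf a.+1 b.+1.
(* [n.+1] rather than [n] keeps the interval nondegenerate, as the fundamental theorem of calculus
   requires. *)
pose f_ n (y : T) : \bar R := ((- n.+1%:R <= y <= n.+1%:R)%R%:R * dpdf_cdf a b y)%:E.
have md : measurable_fun setT (dpdf_cdf a b).
  exact: (continuous_measurable_fun (@continuous_dpdf_cdf a b)).
have f_E n : (\int[mu]_y f_ n y = (F n.+1%:R - F (- n.+1%:R))%:E)%E.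
  rewrite EFinB -(continuous_derive_FTC2 _ (is_derive_pdf_cdf a b) (@continuous_dpdf_cdf a b)); last first.
    by rewrite gtrN.
  rewrite [RHS]integral_mkcond; apply: eq_integral => y _.
  by rewrite patchE mem_setE in_itv/= /f_; case: ifP => _; rewrite ?mul1r ?mul0r.
have c1 : (\int[mu]_y f_ n y)%E @[n --> \oo] --> (\int[mu]_y (dpdf_cdf a b y)%:E)%E.
  apply: (@dominated_cvg _ T R mu setT measurableT f_ (fun y => (dpdf_cdf a b y)%:E)
    (fun y => `|(dpdf_cdf a b y)%:E|%E)) => //.
  - move=> n; apply/measurable_EFinP; apply: measurable_funM => //.
    rewrite (_ : (fun _ => _) = fun y : T => if (- n.+1%:R <= y <= n.+1%:R)%R then 1 else 0 : R).
      by apply: measurable_fun_ifT => //; apply: measurable_and; exact: measurable_fun_ler.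
    by apply/funext => y; case: ifP.
  - move=> y _; apply: cvg_near_cst.
    exists (Num.truncn `|y|) => // n /= yn; rewrite /f_.
    have : `|y| <= n.+1%:R.
      by rewrite ltW// (lt_le_trans (truncnS_gt _))// ler_nat ltnS.
    by rewrite ler_norml => ->; rewrite mul1r.
  - exact: integrable_abse.
  - move=> n y _; rewrite /f_ /= lee_fin normrM ler_piMl//.
    by case: (_ && _); rewrite ?normr1 ?normr0.
have c2 : (\int[mu]_y f_ n y)%E @[n --> \oo] --> (0 : R)%:E.
  under eq_fun do rewrite f_E.
  apply: cvg_EFin; first exact: nearW.
  have F0 (s : R) : `|s| = 1 -> F (s * n.+1%:R) @[n --> \oo] --> (0 : R).
    move=> s1; apply: (@squeeze_cvgr _ _ _ _ (fun=> 0) (fun n => 2 * harmonic n)).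
    - apply: nearW => n; rewrite pdf_cdf_ge0/= (le_trans (pdf_cdf_le_pdf _ _ _))//.
      have nE : `|s * n.+1%:R| = n.+1%:R by rewrite normrM s1 mul1r normr_nat.
      by rewrite (le_trans (std_pdf_le_inv _))// nE// ler1n.
    - exact: cvg_cst.
    - by rewrite -[X in _ --> X](mulr0 2); apply: cvgMr; exact: cvg_harmonic.
  rewrite -[X in _ --> X](subrr 0) /=; apply: cvgB.
    by have := F0 1 (normr1 _); under eq_fun do rewrite mul1r.
  have := F0 (-1); rewrite normrN1 => /(_ erefl).
  by under eq_fun do rewrite mulN1r.
exact: (cvg_unique _ c1 c2).
Qed.

Lemma integral_by_parts a b :
  (a.+1%:R%:E * \int[mu]_y (y * pdf_cdf a.+1 b.+1 y)%:E =
   b.+1%:R%:E * \int[mu]_y (pdf_cdf a.+2 b y)%:E)%E.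
Proof.
have i1 := integrable_xpdf_cdf a b.+1; have i2 := integrable_pdf_cdf a.+1 b.
have f1 := integrable_fin_num measurableT i1; have f2 := integrable_fin_num measurableT i2.
have := integral_dpdf_cdf a b.
rewrite dpdf_cdfE.
rewrite integralB//; last 2 first.
- exact: integrableZl.
- exact: integrableZl.
rewrite !integralZl//.
move: f1 f2; case: (integral _ _ _) => // r1 _; case: (integral _ _ _) => // r2 _.
rewrite -!EFinM -EFinB => -[] h; congr EFin; lra.
Qed.

End by_parts.

Section final_limit.
Context {R : realType}.
Local Notation mu := (@lebesgue_measure R).

(** With m = k + p + 1, integration by parts gives (m+1) C(m, k) (p+1) / (k+1), which equals (k+2)
    C(m+1, k+2), the constant of the Steiner coefficient of index k + 1. *)
Lemma integral_gap_density k p :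
  fine (\int[mu]_y (gap_density (k + p.+1) k y)%:E)%E =
  k.+2%:R * 'C((k + p.+1).+1, k.+2)%:R * pdf_cdf_integral k.+1 p :> R.
Proof.
have ib := @integral_by_parts R k p.
have f1 := integrable_fin_num measurableT (integrable_xpdf_cdf (R := R) k p.+1).
have f2 := integrable_fin_num measurableT (integrable_pdf_cdf (R := R) k.+1 p).
transitivity (fine (((k + p.+1).+1 * 'C(k + p.+1, k))%:R%:E *
    \int[mu]_y (y * pdf_cdf k.+1 p.+1 y)%:E)%E).
  congr fine; rewrite -integralZl//; last exact: integrable_xpdf_cdf.
  apply: eq_integral => y _; rewrite -EFinM; congr EFin.
  rewrite /gap_density /pdf_cdf addKn (exprSr (std_pdf y)) natrM.
  move: (std_cdf y ^+ _) (std_pdf y ^+ _) => c e.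
  move: (_.+1%:R : R) ('C(_, _)%:R : R) => a b; ring.
rewrite /pdf_cdf_integral -/(pdf_cdf k.+2 p _).
move: ib; rewrite -(fineK f1) -(fineK f2) -!EFinM => -[].
set I1 := fine _; rewrite [in RHS](_ : fine _ = fine (\int[mu]_y (pdf_cdf k.+2 p y)%:E)%E)//.
set I2 := fine _ => ib /=.
have k1 : k.+1%:R != 0 :> R by rewrite pnatr_eq0.
apply: (mulfI k1); rewrite mulrCA ib.
rewrite !mulrA -!natrM; congr (_%:R * _).
rewrite -[LHS]mulnA -[RHS]mulnA -mul_bin_diag/= [RHS]mulnCA.
by rewrite mul_bin_left addKn [(p.+1 * _)%N]mulnC.
Qed.

End final_limit.

Theorem theorem4p2 (R : realType) (n k : nat) (d : measure_display)
    (Omega : measurableType d) (P : probability Omega R)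
    (xi : 'I_n -> {RV P >-> R}) :
  (1 <= k < n)%N ->
  mutually_independent xi ->
  (forall i, standard_normal (xi i)) ->
  let rescaled_mean (eps : R) : \bar R :=
    ((eps ^ (1 - k%:Z))%:E *
     'E_P[fun w => (max_coord (fun i => xi i w) *
                    \1_(top_gap_event xi k eps) w)%R])%E in
  cvg (rescaled_mean eps @[eps --> 0^'+]) /\
  (intrinsic_volume (std_simplex R n) k)%:E =
    (((2 * pi) `^ (k%:R / 2) / k`!%:R)%:E *
     lim (rescaled_mean eps @[eps --> 0^'+]))%E.
Proof.
(* From here on [k] and [m] stand for the original k - 1 and n - 1: the coordinates other than the
   maximum, [k] of them required near it. *)
case: k n xi => [//|k] [//|m] xi; move=> /andP[_]; rewrite ltnS => km indep normal rescaled_mean.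
have [p mE] : exists p, m = (k + p.+1)%N.
  by exists (m - k).-1; rewrite prednK ?subn_gt0// subnKC// ltnW.
have km' := ltnW km.
have rE eps : 0 < eps ->
    rescaled_mean eps = (fine (\int[lebesgue_measure]_y (scaled_gap m k eps y)%:E)%E)%:E.
  move=> e0; have ip := integrable_scaled_gap km' e0.
  have en0 : eps ^+ k != 0 by rewrite expf_neq0// gt_eqF.
  rewrite fineK; last exact: integrable_fin_num ip.
  rewrite /rescaled_mean (expectation_gap km' (ltW e0) indep normal).
  have -> : 1 - k.+1%:Z = - k%:Z by lia.
  rewrite -exprnN -integralZl//; last first.
    rewrite (_ : (fun y => _) = fun y => ((eps ^+ k)%:E * (scaled_gap m k eps y)%:E)%E).
      exact: integrableZl.
    apply/funext => y; rewrite -EFinM /scaled_gap; congr EFin.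
    by move: (eps ^+ k) en0 => c c0; field.
  by apply: eq_integral => y _; rewrite -EFinM /scaled_gap; congr EFin; ring.
set L : R := fine (\int[lebesgue_measure]_y (gap_density m k y)%:E)%E.
have cL : rescaled_mean eps @[eps --> 0^'+] --> L%:E.
  apply: cvg_trans; first apply: (near_eq_cvg (f := fun eps =>
    (fine (\int[lebesgue_measure]_y (scaled_gap m k eps y)%:E)%E)%:E)).
    near=> eps; apply/esym/rE; near: eps; exact: nbhs_right_gt.
  by apply: cvg_EFin; [exact: nearW|exact: cvg_integral_scaled_gap].
split; first by apply/cvg_ex; exists L%:E.
rewrite (cvg_lim _ cL)// -EFinM; congr EFin.
(* The Steiner coefficients of the simplex, extended by 0 from index n on. *)
pose V j : R := if (j < m.+1)%N then j.+1%:R * 'C(m.+1, j.+1)%:R / j`!%:R *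
      ((2 * pi) `^ (j%:R / 2) * pdf_cdf_integral j (m.+1 - j.+1)) else 0.
have VS : steiner_formula (std_simplex R m.+1) V.
  apply: steiner_std_simplex => //; last by rewrite /V ltnn.
  by move=> j jm; rewrite /V jm.
rewrite (intrinsic_volumeE _ VS) ?ltnS// /V ltnS km /L mE integral_gap_density.
have -> : ((k + p.+1).+1 - k.+2 = p)%N by lia.
ring.
Unshelve. all: by end_near.
Qed.
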